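(* There exists $c>0$ such that for every modulus of continuity $\omega$, for every $f\in\Lambda_\omega(\mathbb R)$, for arbitrary bounded self-adjoint operators $A$ and $B$, and a bounded nonzero operator $R$ on Hilbert space the following inequality holds: $$\|f(A)R-Rf(B)\|\le c\,\|f\|_{\Lambda_\omega(\mathbb R)}\,\|R\|\,\omega_*\!\left(\frac{\|AR-RB\|}{\|R\|}\right).$$
   Context: A modulus of continuity is a nondecreasing continuous function $\omega$ on $[0,\infty)$ such that $\omega(0)=0$, $\omega(x)>0$ for $x>0$, and $\omega(x+y)\le\omega(x)+\omega(y)$ for $x,y\in[0,\infty)$. $\Lambda_\omega(\mathbb R)$ is the space of functions $f$ on $\mathbb R$ with $$\|f\|_{\Lambda_\omega(\mathbb R)}=\sup_{x\ne y}\frac{|f(x)-f(y)|}{\omega(|x-y|)}<\infty .$$ For $x>0$, $\omega_*(x)=x\int_x^\infty\frac{\omega(t)}{t^2}\,dt$ (possibly $+\infty$), and $\omega_*(0)=0$. *)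

(* Defs.v *)
From HB Require Import structures.
From mathcomp Require Import all_boot all_order all_algebra.
From mathcomp Require Import complex.
From mathcomp Require Import all_classical all_reals all_analysis.

Set Implicit Arguments.
Unset Strict Implicit.
Unset Printing Implicit Defensive.

Import Order.TTheory GRing.Theory Num.Theory.
Import numFieldNormedType.Exports.

Local Open Scope classical_set_scope.
Local Open Scope complex_scope.
Local Open Scope ring_scope.

Section Moduli.
Context {R : realType}.
Implicit Types (w : R -> R) (f : R -> R[i]).

(* A modulus lives on [0, +oo[; values of [w] at negative reals are irrelevant. *)
Definition modulus_of_continuity w : Prop :=
  [/\ {in `[0, +oo[ &, {homo w : x y / x <= y}},
      {within `[0, +oo[, continuous w},
      w 0 = 0,
      (forall x, 0 < x -> 0 < w x) &
      (forall x y, 0 <= x -> 0 <= y -> w (x + y) <= w x + w y)].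

(* Norms over [R[i]] take their values in [R[i]]; they are real numbers there,
   so that taking the real part loses nothing. *)
Definition rnorm (V : normedZmodType R[i]) (x : V) : R := complex.Re `|x|.

Definition Lambda_norm w f : \bar R :=
  ereal_sup [set (rnorm (f p.1 - f p.2) / w `|p.1 - p.2|)%:E
            | p in [set p : R * R | p.1 != p.2]].

Definition Lambda_space w : set (R -> R[i]) :=
  [set f | (Lambda_norm w f < +oo)%E].

Definition omega_star w (x : R) : \bar R :=
  if 0 < x then
    (x%:E * \int[lebesgue_measure]_(t in `[x, +oo[) (w t / t ^+ 2)%:E)%E
  else 0%E.

End Moduli.

Section Operators.
Context {R : realType} {H : completeNormedModType R[i]}.
Implicit Types (S T A : H -> H) (f : R -> R[i]).

(* [H] is a Hilbert space as soon as its (complete) norm is the one of an inner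
   product; [ip] is linear in its first argument. *)
Definition hilbert_inner (ip : {dot H for Num.conj}) : Prop :=
  forall x : H, `|x| ^+ 2 = ip x x.

Definition bounded_operator T : Prop :=
  linear T /\ exists M : R, forall x, rnorm (T x) <= M * rnorm x.

Definition self_adjoint (ip : {dot H for Num.conj}) T : Prop :=
  forall x y, ip (T x) y = ip x (T y).

(* Meaningful for bounded operators only: [sup] of an unbounded set is 0. *)
Definition opnorm T : R := sup [set rnorm (T x) | x in [set x | rnorm x <= 1]].

Definition spectrum T : set R[i] :=
  [set l | ~ exists S, [/\ bounded_operator S,
                           (forall x, S (T x - l *: x) = x) &
                           (forall x, T (S x) - l *: S x = x)]].

Definition poly_op (p : {poly R[i]}) T : H -> H :=
  fun x => \sum_(i < size p) p`_i *: iter i T x.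

(* Continuous functional calculus of a bounded self-adjoint [A], whose spectrum
   is real: [S = f(A)] when [S] is the limit in operator norm of [p_n(A)] for
   polynomials [p_n] that converge to [f] uniformly on the spectrum of [A]. *)
Definition is_fun_calc f A S : Prop :=
  bounded_operator S /\
  exists p : nat -> {poly R[i]},
    (forall e : R, 0 < e -> \forall n \near \oo, forall t : R,
       spectrum A t%:C -> rnorm ((p n).[t%:C] - f t) < e) /\
    (fun n => opnorm (S \- poly_op (p n) A)) @ \oo --> (0 : R).

(* For [A] bounded self-adjoint and [f] continuous on the spectrum of [A], there
   is exactly one [S] with [is_fun_calc f A S]; [\0] is a junk value. *)
Definition fun_calc f A : H -> H := xget (\0 : H -> H) (is_fun_calc f A).

End Operators.

(* Main.v *)
Require Import Defs.
From mathcomp Require Import all_boot all_order all_algebra.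
From mathcomp Require Import complex.
From mathcomp Require Import ring lra.
From mathcomp Require Import all_classical all_reals all_analysis measurable_realfun.

Set Implicit Arguments.
Unset Strict Implicit.
Unset Printing Implicit Defensive.

Import Order.TTheory GRing.Theory Num.Theory.
Import numFieldNormedType.Exports.

Local Open Scope classical_set_scope.
Local Open Scope complex_scope.
Local Open Scope ring_scope.

                                                                                
                                                                        
                                                                         
                                                                                 
                                                                            
                                                            
                                     
                                                                               
                                                                             
                                                                             
                                                                                
                                                                         

                                    

(** Write [[X]] for [A X - X B], which is [commutator A B X] below. The heart of the proof is an
    estimate at one scale [h], carried by [local_commutator] and [local_step]: if [Y], [[Y] / h] and
    [[[Y]] / h^2] all have norm at most [eta], then [f(A) Y - Y f(B)] has norm at most
    [34 L w(h) eta], where [L] is the norm of [f]. Indeed, on the spectrum of [A] take a partition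
    of unity by tents of width [h]. On each tent [f] is within [O(L w(h))] of its value at the node.
    On the side of [B], where [f] may be far from that value, divide [f - f(node)] by the square of
    an affine function that has no real zero. The quotients are square summable over the nodes, and
    moving the two affine factors through [Y] costs at most two commutators. The resulting sums of
    products are bounded by Cauchy-Schwarz ([calc_multiplier]).

    The given operator [T] controls [[T]] only, so it is cut into dyadic pieces. With Cayley
    transforms [U] of [A] and [W] of [B], averaging [U^j T W^j] over about [1/h] units of time gives
    an operator whose second commutator is [O(h)] times the bound on [[T]], and which differs from
    [T] by [O(1/h)] times that bound ([smoothing]). Let [t] be the norm of [T] and let [d t] be that
    of [[T]]. The difference of the averages at the scales [2^k d] and [2^(k+1) d] satisfies the
    local estimate at scale [2^(k+1) d] with [eta] of order [2^-(k+1) t]. Once the scale exceeds the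
    norms of [A] and [B], the average is [T] itself. Summing gives [t] times a sum of
    [2^-k w(2^k d)] ([commutator_telescope]), which is a Riemann sum for [omega_star w d]
    ([modulus_omega_star]).

    The functional calculus is developed on the way. Its key bound is [poly_op_le]: the norm of
    [p(A)] is at most the maximum of [p] on the spectrum. [calc_fun_calc] connects it with
    [fun_calc]. *)

(** * Real-valued norms over the complex scalars *)

Section RealNorm.
Context {R : realType}.

Section NormedZmod.
Context {V : normedZmodType R[i]}.
Implicit Types x y : V.

Lemma rnormC x : `|x| = (rnorm x)%:C.
Proof. by rewrite /rnorm RRe_real. Qed.

Lemma rnorm_ge0 x : 0 <= rnorm x.
Proof. by rewrite -ler0c -rnormC. Qed.

Lemma rnorm0 : rnorm (0 : V) = 0.
Proof. by rewrite /rnorm normr0. Qed.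

Lemma rnormN x : rnorm (- x) = rnorm x.
Proof. by rewrite /rnorm normrN. Qed.

Lemma rnorm_eq0 x : rnorm x = 0 -> x = 0.
Proof. by move=> h; apply/eqP; rewrite -normr_eq0 rnormC h. Qed.

Lemma ler_rnormD x y : rnorm (x + y) <= rnorm x + rnorm y.
Proof. by rewrite -lecR rmorphD/= -!rnormC ler_normD. Qed.

Lemma ler_rnormB x y : rnorm (x - y) <= rnorm x + rnorm y.
Proof. by rewrite -(rnormN y) ler_rnormD. Qed.

Lemma rnorm_distC x y : rnorm (x - y) = rnorm (y - x).
Proof. by rewrite -rnormN opprB. Qed.

Lemma ler_rnorm_sum (I : Type) (r : seq I) (P : pred I) (F : I -> V) :
  rnorm (\sum_(i <- r | P i) F i) <= \sum_(i <- r | P i) rnorm (F i).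
Proof.
elim/big_ind2: _ => [|a b c d ab cd|//]; first by rewrite rnorm0.
by rewrite (le_trans (ler_rnormD _ _))// lerD.
Qed.

End NormedZmod.

Lemma rnormZ (V : normedModType R[i]) (a : R[i]) (x : V) :
  rnorm (a *: x) = rnorm a * rnorm x.
Proof. by apply: complexI; rewrite -rnormC normrZ !rnormC rmorphM. Qed.

Lemma rnormM (a b : R[i]) : rnorm (a * b) = rnorm a * rnorm b.
Proof. by apply: complexI; rewrite -rnormC normrM !rnormC rmorphM. Qed.

Lemma rnormV (a : R[i]) : rnorm a^-1 = (rnorm a)^-1.
Proof. by apply: complexI; rewrite -rnormC normfV rnormC fmorphV. Qed.

Lemma rnorm_real (r : R) : rnorm r%:C = `|r|.
Proof. by rewrite /rnorm normc_def/= expr0n addr0 sqrtr_sqr. Qed.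

Lemma rnorm_conj (a : R[i]) : rnorm a^* = rnorm a.
Proof. by rewrite /rnorm norm_conjC. Qed.

Lemma rnorm_sqr (a : R[i]) : rnorm a ^+ 2 = complex.Re a ^+ 2 + complex.Im a ^+ 2.
Proof.
case: a => a b; rewrite /rnorm normc_def/= sqr_sqrtr// addr_ge0// sqr_ge0//.
Qed.

Lemma rnorm1 : rnorm (1 : R[i]) = 1.
Proof. by rewrite (rnorm_real 1) normr1. Qed.

End RealNorm.

(** The standard way below to pass to the limit: an inequality proved with an error [C / (n + 1)]
    holds without error. *)
Lemma cvg0_le {R : realType} (C x : R) (d : nat -> R) : d @ \oo --> (0 : R) ->
  (forall n, x <= C * d n) -> x <= 0.
Proof.
move=> d0 xd; apply/ler_addgt0Pr => e e0; rewrite add0r.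
have : (fun n => C * d n) @ \oo --> (0 : R).
  by rewrite -[0](mulr0 C); apply: cvgMr.
move=> /cvgr_lt /(_ _ e0) [N _ /(_ N (leqnn N))] /ltW.
exact: le_trans.
Qed.

(** * Operator bounds, completeness, and inversion by Neumann series *)

Section Operators.
Context {R : realType} {H : completeNormedModType R[i]}.
Implicit Types (S T A : H -> H).

Section Linear.
Variables (T : H -> H).
Hypothesis linT : linear T.

Lemma linear_fD x y : T (x + y) = T x + T y.
Proof. by have := linT 1 x y; rewrite !scale1r. Qed.

Lemma linear_f0 : T 0 = 0.
Proof. by have := linT (-1) 0 0; rewrite scaler0 addr0 scaleN1r addNr. Qed.

Lemma linear_fZ a x : T (a *: x) = a *: T x.
Proof. by have := linT a x 0; rewrite linear_f0 !addr0. Qed.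

Lemma linear_fN x : T (- x) = - T x.
Proof. by rewrite -scaleN1r linear_fZ scaleN1r. Qed.

Lemma linear_fB x y : T (x - y) = T x - T y.
Proof. by rewrite linear_fD linear_fN. Qed.

Lemma linear_fsum (I : Type) (r : seq I) (P : pred I) (F : I -> H) :
  T (\sum_(i <- r | P i) F i) = \sum_(i <- r | P i) T (F i).
Proof. by elim/big_rec2: _ => [|i y z _ <-]; rewrite ?linear_f0 ?linear_fD. Qed.

End Linear.

(** An upper bound carried as an explicit constant: sums, compositions and weakenings become rules
    on constants, and the supremum in [opnorm] is rarely touched. *)
Definition opb (K : R) T := linear T /\ forall x, rnorm (T x) <= K * rnorm x.

Lemma opb_bounded K T : opb K T -> bounded_operator T.
Proof. by move=> [lT bT]; split=> //; exists K. Qed.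

Lemma bounded_opb T : bounded_operator T -> exists2 K, 0 < K & opb K T.
Proof.
move=> [lT [K bT]]; exists (`|K| + 1); first by rewrite ltr_wpDl.
split=> // x; rewrite (le_trans (bT x))// ler_wpM2r ?rnorm_ge0//.
by rewrite (le_trans (ler_norm _))// lerDl.
Qed.

Lemma opb_le K L T : K <= L -> opb K T -> opb L T.
Proof.
move=> KL [lT bT]; split=> // x.
by rewrite (le_trans (bT x))// ler_wpM2r ?rnorm_ge0.
Qed.

Lemma opb_id : opb 1 id.
Proof. by split=> // x; rewrite mul1r. Qed.

Lemma opb_comp K L S T : 0 <= K -> opb K S -> opb L T -> opb (K * L) (S \o T).
Proof.
move=> K0 [lS bS] [lT bT]; split=> [a x y|x] /=; first by rewrite lT lS.
by rewrite (le_trans (bS _))// -mulrA ler_wpM2l.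
Qed.

Lemma opbD K L S T : opb K S -> opb L T -> opb (K + L) (S \+ T).
Proof.
move=> [lS bS] [lT bT]; split=> [a x y|x] /=.
  by rewrite lT lS scalerDr addrACA.
by rewrite mulrDl (le_trans (ler_rnormD _ _))// lerD.
Qed.

Lemma opbN K S : opb K S -> opb K (\- S).
Proof.
move=> [lS bS]; split=> [a x y|x] /=; last by rewrite rnormN.
by rewrite lS opprD scalerN.
Qed.

Lemma opbB K L S T : opb K S -> opb L T -> opb (K + L) (S \- T).
Proof. by move=> bS /opbN; apply: opbD. Qed.

Lemma opbZ K a S : opb K S -> opb (rnorm a * K) (a \*: S).
Proof.
move=> [lS bS]; split=> [b x y|x] /=.
  by rewrite lS scalerDr !scalerA mulrC.
by rewrite rnormZ -mulrA ler_wpM2l ?rnorm_ge0.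
Qed.

Lemma opb_scale a : opb (rnorm a) (fun x => a *: x).
Proof. by have := opbZ a opb_id; rewrite mulr1. Qed.

Lemma opb_zero : opb 0 (\0 : H -> H).
Proof. by split=> [a x y|x] /=; rewrite ?scaler0 ?addr0// rnorm0 mul0r. Qed.

Lemma opb_sum (I : Type) (r : seq I) (K : I -> R) (F : I -> H -> H) :
  (forall i, opb (K i) (F i)) ->
  opb (\sum_(i <- r) K i) (fun x => \sum_(i <- r) F i x).
Proof.
move=> bF; elim: r => [|i r IH].
  rewrite big_nil (_ : (fun _ => _) = \0); first exact: opb_zero.
  by apply/funext => x; rewrite big_nil.
rewrite big_cons (_ : (fun _ => _) = F i \+ fun x => \sum_(j <- r) F j x).
  exact: opbD.
by apply/funext => x; rewrite big_cons.
Qed.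

Lemma opb_iter K T n : 0 <= K -> opb K T -> opb (K ^+ n) (iter n T).
Proof.
move=> K0 bT; elim: n => [|n IH]; first exact: opb_id.
by rewrite exprS; apply: opb_comp.
Qed.


(** Completeness with a rate: the Cauchy bound [d] passes to the limit, so later arguments keep
    explicit error terms. *)
Lemma rnorm_complete (u : nat -> H) (d : nat -> R) : d @ \oo --> (0 : R) ->
  (forall n m, (n <= m)%N -> rnorm (u m - u n) <= d n) ->
  exists l, forall n, rnorm (l - u n) <= d n.
Proof.
move=> d0 ud.
have Re_gt0 (e : R[i]) : 0 < e -> e = (complex.Re e)%:C /\ 0 < complex.Re e.
  move=> e0; have eE : e = (complex.Re e)%:C by rewrite RRe_real// gtr0_real.
  by split=> //; rewrite -ltcR -eE.
have /cvg_ex[l ul] : cvg (u @ \oo).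
  apply: cauchy_cvg; apply: cauchy_exP => e e0.
  have [eE {}e0] := Re_gt0 e e0.
  have [N _ /(_ N (leqnn N))] : \forall n \near \oo, d n < complex.Re e.
    by near=> n; near: n; apply: cvgr_lt d0 _ e0.
  move=> dNe; exists (u N), N => // n /= Nn.
  rewrite -ball_normE /ball_ /= distrC rnormC eE ltcR.
  by rewrite (le_lt_trans (ud _ _ Nn)).
exists l => n; apply/ler_addgt0Pr => e e0.
have eC : 0 < e%:C by rewrite ltcR.
move/cvgrPdist_lt : ul => /(_ _ eC) [N _ HN].
have /= := HN (maxn N n) (leq_maxl _ _); rewrite rnormC ltcR => le.
rewrite -(subrK (u (maxn N n)) l) -addrA addrC (le_trans (ler_rnormD _ _))//.
by rewrite lerD// ?ud ?leq_maxr// ltW.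
Unshelve. all: by end_near. Qed.

                                                                              
                                                                             
                
(** Up to the scalar [c], [L] is a perturbation of the identity of size [q < 1]. The triangle
    inequality bounds [L] from below, hence injectivity and a bounded inverse; a Neumann series
    gives surjectivity. The freedom in [c] is what places points outside the spectrum. *)
Lemma contraction_inverse K q (c : R[i]) L : 0 <= K -> opb K L -> 0 <= q < 1 -> c != 0 ->
  (forall u, rnorm (u - c *: L u) <= q * rnorm u) ->
  exists S, [/\ bounded_operator S, forall x, S (L x) = x & forall x, L (S x) = x].
Proof.
move=> K0 [lL bL] /andP[q0 q1] c0 hc.
have q1' : 0 < 1 - q by rewrite subr_gt0.
pose G u := u - c *: L u.
have lG : linear G.
  by move=> a x y; rewrite /G lL !scalerDr !scalerA opprD addrACA scalerN !scalerA (mulrC c).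
have bG : opb q G by split.
have lb u : rnorm u <= rnorm c / (1 - q) * rnorm (L u).
  rewrite mulrAC ler_pdivlMr// mulrBr mulr1 mulrC lerBlDr -rnormZ.
  rewrite -{1}(subrK (c *: L u) u) addrC (le_trans (ler_rnormD _ _))//.
  by rewrite lerD// hc.
have injL x y : L x = L y -> x = y.
  move=> Lxy; apply/eqP; rewrite -subr_eq0; apply/eqP/rnorm_eq0/eqP.
  by rewrite eq_le rnorm_ge0 andbT (le_trans (lb _))// linear_fB// Lxy subrr rnorm0 mulr0.
have surjL y : exists x, L x = y.
  (* Partial sums of the Neumann series for the inverse of [c L = 1 - G], applied to [c y]; the
     defect after [n] terms is [G^n (c y)]. *)
  pose s n := \sum_(i < n) iter i G (c *: y).
  have Gs n : c *: L (s n) = c *: y - iter n G (c *: y).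
    have -> : c *: L (s n) = s n - G (s n) by rewrite /G opprB addrC subrK.
    rewrite /s linear_fsum// -sumrB; elim: n => [|n IH]; first by rewrite big_ord0 subrr.
    by rewrite big_ord_recr/= IH addrA subrK.
  have iterG i : rnorm (iter i G (c *: y)) <= q ^+ i * rnorm (c *: y).
    by have [] := opb_iter i q0 bG.
  have [||l sl] := @rnorm_complete s (fun n => geometric (rnorm (c *: y) / (1 - q)) q n).
  - by apply: cvg_geometric; rewrite ger0_norm.
  - move=> n m nm; rewrite /geometric /=.
    (* The finite geometric tail is kept as [q^n - q^m], a form that induction on [m] reproduces
       exactly. *)
    apply: (@le_trans _ _ (rnorm (c *: y) / (1 - q) * (q ^+ n - q ^+ m))); last first.
      by rewrite ler_wpM2l ?divr_ge0 ?rnorm_ge0 ?(ltW q1')// gerBl exprn_ge0.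
    elim: m nm => [|m IH]; first by rewrite leqn0 => /eqP ->; rewrite !subrr rnorm0 mulr0.
    rewrite leq_eqVlt => /predU1P[->|]; first by rewrite !subrr rnorm0 mulr0.
    rewrite ltnS => /IH {}IH; rewrite /s big_ord_recr/= addrAC.
    rewrite (le_trans (ler_rnormD _ _))// (le_trans (lerD IH (iterG m)))//.
    by rewrite exprS le_eqVlt; apply/orP; left; apply/eqP; field; rewrite gt_eqF.
  exists l; apply/eqP; rewrite -subr_eq0; apply/eqP/(scalerI c0); rewrite scaler0.
  apply/rnorm_eq0/eqP; rewrite eq_le rnorm_ge0 andbT.
  have d0 : geometric 1 q @ \oo --> (0 : R) by apply: cvg_geometric; rewrite ger0_norm.
  apply: (@cvg0_le _ (rnorm c * K * (rnorm (c *: y) / (1 - q)) + rnorm (c *: y)) _ _ d0) => n.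
  rewrite /geometric /= mul1r scalerBr.
  have -> : c *: L l - c *: y = c *: L (l - s n) - iter n G (c *: y).
    by rewrite linear_fB// scalerBr Gs opprB addrA [RHS]addrAC addrK.
  rewrite (le_trans (ler_rnormB _ _))// mulrDl lerD//; last by rewrite mulrC.
  rewrite rnormZ -!mulrA ler_wpM2l ?rnorm_ge0// (le_trans (bL _))// ler_wpM2l//.
  by have := sl n; rewrite /geometric /= -mulrA.
have [S LS] := choice surjL.
exists S; split=> [||//]; last by move=> x; apply: injL; rewrite LS.
split=> [a x y|]; first by apply: injL; rewrite lL !LS.
by exists (rnorm c / (1 - q)) => x; rewrite (le_trans (lb _))// LS.
Qed.

End Operators.

                                  

(** * Weierstrass approximation by Bernstein polynomials *)

Section Weierstrass.
Context {R : realType}.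
Implicit Types (phi : R -> R[i]) (g : nat -> R[i]).

                                                                              
                                                           
(** The mean of [g] over a binomial variable with [n] trials and success probability [S], obtained
    by conditioning on one trial. The recursion replaces all manipulation of binomial
    coefficients. *)
Fixpoint bernstein (S : {poly R[i]}) n g : {poly R[i]} :=
  if n is m.+1 then
    (1 - S) * bernstein S m g + S * bernstein S m (fun k => g k.+1)
  else (g 0%N)%:P.

(** The right-hand side is the mean of [a + b (k - x)^2] under the binomial law: squared bias plus
    variance. A success in the conditioned trial shifts [g], which amounts to replacing [x] by
    [x - 1]. *)
Lemma bernstein_bound (S : {poly R[i]}) (t s : R) n g c a b x :
  S.[t%:C] = s%:C -> 0 <= s <= 1 ->
  (forall k, (k <= n)%N -> rnorm (g k - c) <= a + b * (k%:R - x) ^+ 2) ->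
  rnorm ((bernstein S n g).[t%:C] - c) <=
    a + b * ((n%:R * s - x) ^+ 2 + n%:R * s * (1 - s)).
Proof.
move=> St /andP[s0 s1]; elim: n g x => [|n IH] g x gk.
  by rewrite /= hornerC !mul0r addr0; apply: gk.
rewrite /= hornerD !hornerM hornerD hornerN hornerC St.
set u := (X in rnorm (_ * X + _ - _)); set v := (X in rnorm (_ + _ * X - _)).
have -> : (1 - s%:C) * u + s%:C * v - c = (1 - s)%:C * (u - c) + s%:C * (v - c).
  by rewrite rmorphB/= rmorph1; ring.
rewrite (le_trans (ler_rnormD _ _))// !rnormM !rnorm_real !ger0_norm ?subr_ge0//.
have hu := IH g x (fun k kn => gk k (leqW kn)).
have hv : rnorm (v - c) <= a + b * ((n%:R * s - (x - 1)) ^+ 2 + n%:R * s * (1 - s)).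
  apply: IH => k kn; have := gk k.+1 kn.
  by rewrite -natr1 opprB addrA.
have s1' : 0 <= 1 - s by rewrite subr_ge0.
apply: (le_trans (lerD (ler_wpM2l s1' hu) (ler_wpM2l s0 hv))).
by rewrite -natr1 le_eqVlt; apply/orP; left; apply/eqP; ring.
Qed.

                                                                         
                                                           
(** The hypothesis is uniform continuity in quadratic form, which is what the second moment of the
    binomial law can absorb (Chebyshev's argument). *)
Lemma Weierstrass (M : R) phi : 0 < M ->
  (forall e : R, 0 < e -> exists C : R, forall x y, `|x| <= M -> `|y| <= M ->
    rnorm (phi x - phi y) <= e + C * (x - y) ^+ 2) ->
  forall e : R, 0 < e -> exists p : {poly R[i]}, forall t : R, `|t| <= M ->
    rnorm (p.[t%:C] - phi t) <= e.
Proof.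
move=> M0 hphi e e0.
have e20 : 0 < e / 2 by rewrite divr_gt0.
have [C hC] := hphi _ e20.
(* On [[-M, M]] the rescaled binomial variable has variance [4 M^2 s (1 - s) / n], at most
   [M^2 / n]; this [n] makes [C] times it at most [e / 2]. *)
pose n := (Num.truncn (`|C| * M ^+ 2 / (e / 2))).+1.
have nP : `|C| * M ^+ 2 / n%:R <= e / 2.
  by rewrite ler_pdivrMr ?ltr0n// [leRHS]mulrC -ler_pdivrMr// ltW// truncnS_gt.
pose S : {poly R[i]} := ((2 * M)^-1)%:C *: ('X + M%:C%:P).
pose g k := phi (- M + 2 * M * (k%:R / n%:R)).
exists (bernstein S n g) => t tM.
pose s := (t + M) / (2 * M).
have n0 : (n%:R : R) != 0 by rewrite pnatr_eq0.
have tE : t = - M + 2 * M * s by rewrite /s; field; rewrite gt_eqF.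
have s01 : 0 <= s <= 1.
  move: tM; rewrite ler_norml => /andP[t1 t2].
  by rewrite divr_ge0 ?ler_pdivrMr/= ?mulr_gt0//; lra.
apply: (@le_trans _ _ (e / 2 + C * (2 * M / n%:R) ^+ 2 *
   ((n%:R * s - n%:R * s) ^+ 2 + n%:R * s * (1 - s)))).
  apply: bernstein_bound => //.
    rewrite /S hornerZ hornerD hornerX hornerC -rmorphD -rmorphM/=.
    by rewrite /s mulrC.
  move=> k kn; rewrite /g.
  have k01 : 0 <= (k%:R / n%:R : R) <= 1.
    by rewrite divr_ge0//= ler_pdivrMr ?ltr0n// mul1r ler_nat.
  apply: (le_trans (hC _ _ _ tM)).
    rewrite ler_norml; move/andP: k01 => [k0 k1]; apply/andP; split.
      by rewrite -subr_ge0; have := mulr_ge0 (ltW M0) k0; lra.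
    by have := ler_wpM2l (ltW M0) k1; lra.
  by rewrite lerD2l {1}tE le_eqVlt; apply/orP; left; apply/eqP; field.
rewrite [leRHS](_ : e = e / 2 + e / 2); last by field.
rewrite lerD2l subrr expr0n/= add0r; apply: le_trans nP.
have -> : C * (2 * M / n%:R) ^+ 2 * (n%:R * s * (1 - s)) =
          C * M ^+ 2 / n%:R * (4 * s * (1 - s)) by field.
case/andP: s01 => s0 s1.
have q0 : 0 <= 4 * s * (1 - s) by apply: mulr_ge0; [apply: mulr_ge0|rewrite subr_ge0].
have q1 : 4 * s * (1 - s) <= 1 by have := sqr_ge0 (2 * s - 1); lra.
have : C * M ^+ 2 / n%:R <= `|C| * M ^+ 2 / n%:R.
  by rewrite ler_wpM2r// ler_wpM2r ?ler_norm// sqr_ge0.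
have : 0 <= `|C| * M ^+ 2 / n%:R by rewrite divr_ge0// mulr_ge0// sqr_ge0.
nra.
Qed.

End Weierstrass.

                               

(** * The real inner product and adjoint bounds *)

Section InnerProduct.
Context {R : realType} {H : completeNormedModType R[i]}.
Variable ip : {dot H for Num.conj}.
Hypothesis hip : hilbert_inner ip.
Implicit Types (x y u v : H).

Definition rip x y : R := complex.Re (ip x y).

Lemma ipC x y : ip x y = (ip y x)^*.
Proof. by rewrite hermC/= expr0 mul1r. Qed.

Lemma ripC x y : rip x y = rip y x.
Proof. by rewrite /rip ipC; case: (ip y x). Qed.

Lemma ripDl x y z : rip (x + y) z = rip x z + rip y z.
Proof. by rewrite /rip linearDl raddfD. Qed.

Lemma ripDr x y z : rip z (x + y) = rip z x + rip z y.
Proof. by rewrite ripC ripDl !(ripC z). Qed.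

Lemma ripNl x y : rip (- x) y = - rip x y.
Proof. by rewrite /rip linearNl raddfN. Qed.

Lemma ripNr x y : rip y (- x) = - rip y x.
Proof. by rewrite ripC ripNl ripC. Qed.

Lemma ripZl (r : R) x y : rip (r%:C *: x) y = r * rip x y.
Proof. by rewrite /rip linearZl_LR/=; case: (ip x y) => a b /=; rewrite mul0r subr0. Qed.

Lemma rip_suml (I : Type) (r : seq I) (F : I -> H) y :
  rip (\sum_(i <- r) F i) y = \sum_(i <- r) rip (F i) y.
Proof.
elim: r => [|i r IH]; last by rewrite !big_cons ripDl IH.
by rewrite !big_nil /rip linear0l.
Qed.

Lemma rip_norm x : rip x x = rnorm x ^+ 2.
Proof. by rewrite /rip -hip rnormC -rmorphXn. Qed.

Lemma rnormD2 x y : rnorm (x + y) ^+ 2 = rnorm x ^+ 2 + rnorm y ^+ 2 + 2 * rip x y.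
Proof. by rewrite -!rip_norm ripDl !ripDr (ripC y x); ring. Qed.

(** The norm is already known to be a norm, so Cauchy-Schwarz for the real part comes from squaring
    the triangle inequality. *)
Lemma rip_le x y : rip x y <= rnorm x * rnorm y.
Proof.
have : rnorm (x + y) ^+ 2 <= (rnorm x + rnorm y) ^+ 2.
  by rewrite ler_sqr ?nnegrE ?addr_ge0 ?rnorm_ge0// ler_rnormD.
by rewrite rnormD2; lra.
Qed.

Lemma adjoint_opb (S S' : H -> H) K : 0 <= K -> opb K S -> linear S' ->
  (forall x y, ip (S x) y = ip x (S' y)) -> opb K S'.
Proof.
move=> K0 [lS bS] lS' adj; split=> // x.
have := rip_le (S (S' x)) x; rewrite /rip adj -/(rip _ _) rip_norm => h.
have {h} := le_trans h (ler_wpM2r (rnorm_ge0 x) (bS (S' x))).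
have := rnorm_ge0 (S' x); rewrite le_eqVlt => /predU1P[<- _|p].
  by rewrite mulr_ge0 ?rnorm_ge0.
by rewrite expr2 mulrAC ler_pM2r.
Qed.

End InnerProduct.

(** * The operator norm as the least bound *)

Section Opnorm.
Context {R : realType} {H : completeNormedModType R[i]}.
Implicit Types (T : H -> H) (K : R).

Lemma opnorm_has_sup T : bounded_operator T ->
  has_sup [set rnorm (T x) | x in [set x : H | rnorm x <= 1]].
Proof.
move=> bT; have [K K0 [lT hT]] := bounded_opb bT.
split; first by exists (rnorm (T 0)), 0 => //=; rewrite rnorm0.
exists K => _ [y /= y1 <-]; rewrite (le_trans (hT _))//.
by rewrite -[leRHS]mulr1 ler_wpM2l// ltW.
Qed.

Lemma opnorm_bound T : bounded_operator T -> opb (opnorm T) T.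
Proof.
move=> bT; have [lT _] := bT; split=> // x.
have := rnorm_ge0 x; rewrite le_eqVlt => /predU1P[x0|x0].
  by rewrite (rnorm_eq0 (esym x0)) linear_f0// !rnorm0 mulr0.
pose y := (rnorm x)^-1%:C *: x.
have y1 : rnorm y <= 1.
  by rewrite rnormZ rnorm_real ger0_norm ?invr_ge0 ?(ltW x0)// mulVf// gt_eqF.
have := @sup_upper_bound _ _ (opnorm_has_sup bT) (rnorm (T y)) (ex_intro2 _ _ y y1 erefl).
rewrite linear_fZ// rnormZ rnorm_real ger0_norm ?invr_ge0 ?(ltW x0)//.
by rewrite ler_pdivrMl// mulrC.
Qed.

Lemma opnorm_ge0 T : bounded_operator T -> 0 <= opnorm T.
Proof.
move=> bT; apply: (@sup_upper_bound _ _ (opnorm_has_sup bT)).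
by exists 0 => /=; rewrite ?linear_f0 ?rnorm0//; case: bT.
Qed.

Lemma opnorm_le T K : 0 <= K -> opb K T -> opnorm T <= K.
Proof.
move=> K0 [_ hT]; apply: ge_sup.
  by exists (rnorm (T 0)), 0 => //=; rewrite rnorm0.
move=> _ [y /= y1 <-]; rewrite (le_trans (hT _))//.
by rewrite -[leRHS]mulr1 ler_wpM2l.
Qed.

End Opnorm.

(** * Polynomials of an operator *)

Section PolyOp.
Context {R : realType} {H : completeNormedModType R[i]}.
Implicit Types (p q : {poly R[i]}) (x y u v : H).
Variable A : H -> H.
Hypothesis lA : linear A.

Lemma poly_op_wide p n x : (size p <= n)%N ->
  poly_op p A x = \sum_(i < n) p`_i *: iter i A x.
Proof.
move=> pn; rewrite /poly_op (big_ord_widen n (fun i => p`_i *: iter i A x))//.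
rewrite big_mkcond/=; apply: eq_bigr => i _; case: ltnP => // h.
by rewrite nth_default// scale0r.
Qed.

Lemma linear_iter n : linear (iter n A).
Proof. by elim: n => [//|n IH] a x y /=; rewrite IH lA. Qed.

Lemma linear_poly_op p : linear (poly_op p A).
Proof.
move=> a x y; rewrite /poly_op scaler_sumr -big_split/=; apply: eq_bigr => i _.
by rewrite linear_iter scalerDr !scalerA mulrC.
Qed.

Lemma poly_opD p q x : poly_op (p + q) A x = poly_op p A x + poly_op q A x.
Proof.
rewrite !(@poly_op_wide _ (maxn (size p) (size q))) ?leq_maxl ?leq_maxr ?size_polyD//.
by rewrite -big_split/=; apply: eq_bigr => i _; rewrite coefD scalerDl.
Qed.

Lemma poly_opZ a p x : poly_op (a *: p) A x = a *: poly_op p A x.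
Proof.
rewrite !(@poly_op_wide _ (size p)) ?size_scale_leq// scaler_sumr.
by apply: eq_bigr => i _; rewrite coefZ scalerA.
Qed.

Lemma poly_opN p x : poly_op (- p) A x = - poly_op p A x.
Proof. by rewrite -scaleN1r poly_opZ scaleN1r. Qed.

Lemma poly_opB p q x : poly_op (p - q) A x = poly_op p A x - poly_op q A x.
Proof. by rewrite poly_opD poly_opN. Qed.

Lemma poly_opC a x : poly_op a%:P A x = a *: x.
Proof. by rewrite (@poly_op_wide _ 1) ?size_polyC_leq1// big_ord1 coefC eqxx. Qed.

Lemma poly_opMX p x : poly_op (p * 'X) A x = A (poly_op p A x).
Proof.
rewrite (@poly_op_wide _ (size p).+1) ?(leq_trans (size_polyMleq _ _))//; last first.
  by rewrite size_polyX addn2.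
rewrite big_ord_recl/= coefMX eqxx scale0r add0r /poly_op linear_fsum//.
by apply: eq_bigr => i _; rewrite coefMX/= linear_fZ.
Qed.

Lemma poly_opX x : poly_op 'X A x = A x.
Proof. by rewrite -['X]mul1r poly_opMX poly_opC scale1r. Qed.

Lemma poly_opM p q x : poly_op (p * q) A x = poly_op p A (poly_op q A x).
Proof.
elim/poly_ind: p => [|p c IH] in x *.
  by rewrite mul0r -[0]polyC0 !poly_opC !scale0r.
rewrite mulrDl mulrAC !poly_opD !poly_opMX IH mul_polyC poly_opZ poly_opC//.
Qed.

Lemma poly_op_opb p (M : R) : 0 <= M -> opb M A ->
  opb (\sum_(i < size p) rnorm p`_i * M ^+ i) (poly_op p A).
Proof.
move=> M0 bA; apply: (@opb_sum _ _ _ _ _ (fun (i : 'I_(size p)) x => p`_i *: iter i A x)).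
by move=> i; apply: opbZ; apply: opb_iter.
Qed.

Lemma poly_op_adj (ip : {dot H for Num.conj}) p x y : self_adjoint ip A ->
  ip (poly_op p A x) y = ip x (poly_op (map_poly Num.conj p) A y).
Proof.
move=> sA; elim/poly_ind: p => [|p c IH] in x y *.
  by rewrite rmorph0 -[0]polyC0 !poly_opC !scale0r linear0l linear0r.
rewrite rmorphD rmorphM/= map_polyX map_polyC/= !poly_opD !poly_opMX !poly_opC.
rewrite linearDl linearDr/= linearZl_LR linearZr_LR/= conjCK sA IH -!poly_opMX.
by rewrite -['X]mul1r mulrA mulr1 poly_opM poly_opX.
Qed.

End PolyOp.

(** * The spectrum of a self-adjoint operator and the norm of its polynomials *)

Section Spectrum.
Context {R : realType} {H : completeNormedModType R[i]}.
Variable ip : {dot H for Num.conj}.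
Hypothesis hip : hilbert_inner ip.
Implicit Types (p q : {poly R[i]}) (x y u v : H).
Variables (A : H -> H) (M : R).
Hypotheses (M0 : 0 < M) (bA : opb M A) (sA : self_adjoint ip A).

Let lA : linear A. Proof. by case: bA. Qed.

Lemma opb_shift (z : R[i]) : opb (M + rnorm z) (fun x => A x - z *: x).
Proof. exact: opbB (opb_scale z). Qed.

                                                                          
(** Pythagoras: the inner product of [u] with [A u - a u] is real, so the factor [i] makes the cross
    term purely imaginary. *)
Lemma rnorm_shift2 (r t a : R) u :
  rnorm (r%:C *: u + (0 +i* t) *: (A u - a%:C *: u)) ^+ 2 =
  r ^+ 2 * rnorm u ^+ 2 + t ^+ 2 * rnorm (A u - a%:C *: u) ^+ 2.
Proof.
rewrite (rnormD2 hip (r%:C *: u)) !rnormZ !exprMn !rnorm_sqr/= expr0n/= !(addr0, add0r).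
have -> : rip ip (r%:C *: u) ((0 +i* t) *: (A u - a%:C *: u)) = 0; last first.
  by rewrite mulr0 addr0.
rewrite ripZl /rip linearZr_LR/= linearBr/= linearZr_LR/=.
have : complex.Im (ip u (A u)) = 0.
  have : ip u (A u) = (ip u (A u))^* by rewrite -[RHS]ipC sA.
  by case: (ip u (A u)) => c d [] /=; lra.
rewrite -hip rnormC -rmorphXn; case: (ip u (A u)) => c d /= ->.
by ring.
Qed.

(** For [z = a + i b] with [b] nonzero, a purely imaginary multiple of [A - z] is close enough to
    the identity for [contraction_inverse]. *)
Lemma spectrum_real (z : R[i]) : spectrum A z -> complex.Im z = 0.
Proof.
apply: contra_notP => z0.
pose a := complex.Re z; pose b := complex.Im z.
have b0 : 0 < b ^+ 2 by rewrite exprn_even_gt0//; apply/eqP.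
pose K := M + `|a|; pose D := b ^+ 2 + K ^+ 2.
have D0 : 0 < D by rewrite ltr_wpDr// sqr_ge0.
have q1 : 0 <= 1 - b ^+ 2 / D < 1.
  rewrite subr_ge0 ler_pdivrMr// mul1r lerDl sqr_ge0/=.
  by rewrite ltrBlDr ltrDl divr_gt0.
(* With [c = i b / D] the remainder is [(1 - b^2/D) u - (i b/D) (A - a) u]. Its squared norm is at
   most [(1 - b^2/D)^2 + b^2 K^2 / D^2] times that of [u], and this factor equals [1 - b^2/D]
   because [D = b^2 + K^2]. *)
apply: (@contraction_inverse _ _ _ (Num.sqrt (1 - b ^+ 2 / D)) (0 +i* (b / D)) _ _ (opb_shift z)).
- by rewrite addr_ge0 ?rnorm_ge0// ltW.
- by rewrite sqrtr_ge0/= -[ltRHS]sqrtr1 ltr_sqrt//; case/andP: q1.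
- rewrite eq_complex/= eqxx/= mulf_eq0 invr_eq0 (gt_eqF D0) orbF; exact/eqP.
move=> u.
rewrite -ler_sqr ?nnegrE ?mulr_ge0 ?rnorm_ge0 ?sqrtr_ge0// exprMn sqr_sqrtr; last first.
  by case/andP: q1.
have -> : u - (0 +i* (b / D)) *: (A u - z *: u) =
    (1 - b ^+ 2 / D)%:C *: u + (0 +i* (- (b / D))) *: (A u - a%:C *: u).
  have zE : z = a%:C + (0 +i* b) by rewrite /a /b; case: (z) => c d; simpc.
  have -> : A u - z *: u = A u - a%:C *: u - (0 +i* b) *: u.
    by rewrite {1}zE scalerDl opprD addrA.
  rewrite scalerBr scalerA opprB addrA; congr (_ + _).
    by rewrite -{1}(scale1r u) -scalerDl; congr (_ *: _); simpc; congr (_ +i* _); ring.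
  by rewrite -scaleNr; congr (_ *: _); simpc.
rewrite rnorm_shift2.
have [_ /(_ u)] : opb K (fun x => A x - a%:C *: x).
  by have := opb_shift a%:C; rewrite rnorm_real.
set t := rnorm (A u - _) => hK.
have K0 : 0 <= K by rewrite addr_ge0// ltW.
have hK2 : t ^+ 2 <= K ^+ 2 * rnorm u ^+ 2.
  by rewrite -exprMn ler_sqr ?nnegrE ?mulr_ge0 ?rnorm_ge0.
rewrite (@le_trans _ _ ((1 - b ^+ 2 / D) ^+ 2 * rnorm u ^+ 2 +
    (b / D) ^+ 2 * (K ^+ 2 * rnorm u ^+ 2)))//.
  by rewrite lerD2l sqrrN ler_wpM2l// sqr_ge0.
rewrite mulrA -mulrDl ler_wpM2r ?sqr_ge0// le_eqVlt; apply/orP; left; apply/eqP.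
by rewrite /D; field; rewrite gt_eqF.
Qed.

(** If [|t| > M], then [c = -1/t] turns the remainder into [A u / t], a contraction. *)
Lemma spectrum_le (t : R) : spectrum A t%:C -> `|t| <= M.
Proof.
rewrite leNgt => h; apply/negP => tM; apply: h.
have t0 : 0 < `|t| by rewrite (lt_trans M0).
have tn0 : t != 0 by rewrite -normr_gt0.
apply: (@contraction_inverse _ _ _ (M / `|t|) (- t^-1)%:C _ _ (opb_shift t%:C)).
- by rewrite addr_ge0 ?rnorm_ge0// ltW.
- by rewrite divr_ge0 ?(ltW M0)//= ltr_pdivrMr// mul1r.
- by rewrite eq_complex/= eqxx andbT oppr_eq0 invr_eq0.
move=> u; rewrite rmorphN/= scaleNr opprK scalerBr scalerA -rmorphM/= mulVf//.
rewrite scale1r addrC subrK rnormZ rnorm_real normfV mulrC mulrAC.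
by rewrite ler_wpM2r ?invr_ge0//; case: bA => _; apply.
Qed.

Lemma inverse_bounded_below (z : R[i]) : ~ spectrum A z ->
  exists2 c, 0 < c & forall u, c * rnorm u <= rnorm (A u - z *: u).
Proof.
move=> /contrapT[S [/bounded_opb[K K0 [lS bS]] SA _]].
exists K^-1; first by rewrite invr_gt0.
by move=> u; rewrite ler_pdivrMl// -{1}(SA u).
Qed.

Definition bounded_below (T : H -> H) :=
  exists2 c : R, 0 < c & forall u, c * rnorm u <= rnorm (T u).

(** Split [q] into linear factors. If no root lay in the spectrum, every factor [A - z] would be
    bounded below, and so would their product. Roots in the spectrum are real by [spectrum_real]. *)
Lemma poly_spectrum q : q != 0 -> ~ bounded_below (poly_op q A) ->
  exists2 t : R, spectrum A t%:C & root q t%:C.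
Proof.
move=> q0 nb; apply: contrapT => nt; apply: nb.
have [r qE] := closed_field_poly_normal q.
have lc0 : lead_coef q != 0 by rewrite lead_coef_eq0.
have hr z : z \in r -> ~ spectrum A z.
  move=> zr sz.
  have zE : z = (complex.Re z)%:C by rewrite {1}(complexE z) (spectrum_real sz) mulr0 addr0.
  apply: nt; exists (complex.Re z).
    by rewrite -zE.
  by rewrite -zE qE rootZ// root_prod_XsubC.
rewrite qE; elim: r hr {qE} => [|z r IH] hr.
  exists (rnorm (lead_coef q)).
    by rewrite lt_neqAle rnorm_ge0 andbT eq_sym; apply: contra lc0 => /eqP/rnorm_eq0 ->.
  by move=> u; rewrite big_nil alg_polyC poly_opC rnormZ.
have [|c c0 hc] := IH; first by move=> y yr; apply: hr; rewrite inE yr orbT.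
have [d d0 hd] := inverse_bounded_below (hr z (mem_head _ _)).
exists (d * c); first exact: mulr_gt0.
move=> u; rewrite big_cons scalerAr poly_opM// poly_opB// poly_opX// poly_opC.
by rewrite (le_trans _ (hd _))// -mulrA ler_wpM2l// ltW.
Qed.


                                                                                
                                                         
(** The square of the norm of [P = p(A)] is an approximate eigenvalue of [P^* P]: a lower bound [c]
    for [P^* P - N^2] would improve the least bound [N]. *)
Lemma poly_op_approx p N : 0 < N -> opb N (poly_op p A) ->
  (forall K, 0 <= K -> opb K (poly_op p A) -> N <= K) ->
  ~ bounded_below (poly_op (p * map_poly Num.conj p - (N ^+ 2)%:C%:P) A).
Proof.
move=> N0 bP leastN [c c0 hc].
pose P' := poly_op (map_poly Num.conj p) A.
have bP' : opb N P'.
  apply: (adjoint_opb hip (ltW N0) bP); first exact: linear_poly_op.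
  by move=> x y; rewrite poly_op_adj.
(* Expanding the squared norm of [(P^* P - N^2) u] gives [c^2 |u|^2 <= N^2 (N^2 |u|^2 - |P u|^2)];
   solving for [|P u|] yields this smaller bound for [P]. *)
pose K := Num.sqrt (N ^+ 2 - c ^+ 2 / N ^+ 2).
have K0 : 0 <= K by apply: sqrtr_ge0.
have N20 : 0 < N ^+ 2 by rewrite exprn_gt0.
have : N <= K.
  apply: leastN => //; split=> [|u]; first exact: linear_poly_op.
  pose a := rnorm (poly_op p A u).
  have h : c ^+ 2 * rnorm u ^+ 2 <= N ^+ 2 * (N ^+ 2 * rnorm u ^+ 2 - a ^+ 2).
    have := hc u; rewrite -ler_sqr ?nnegrE ?mulr_ge0 ?rnorm_ge0 ?(ltW c0)//.
    rewrite exprMn => /le_trans; apply.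
    rewrite poly_opB// mulrC poly_opM// poly_opC (rnormD2 hip (P' _)).
    rewrite rnormN rnormZ rnorm_real ger0_norm ?(ltW N20)// ripNr ripC ripZl.
    have -> : rip ip u (P' (poly_op p A u)) = a ^+ 2.
      by rewrite /rip -poly_op_adj// -/(rip _ _ _) rip_norm.
    have : rnorm (P' (poly_op p A u)) ^+ 2 <= N ^+ 2 * a ^+ 2.
      rewrite -exprMn ler_sqr ?nnegrE ?mulr_ge0 ?rnorm_ge0 ?(ltW N0)//.
      by case: bP' => _; apply.
    by rewrite exprMn; lra.
  have {}h : a ^+ 2 <= (N ^+ 2 - c ^+ 2 / N ^+ 2) * rnorm u ^+ 2.
    rewrite -(ler_pM2l N20).
    rewrite (le_trans _ (_ : N ^+ 2 * (N ^+ 2 * rnorm u ^+ 2) - c ^+ 2 * rnorm u ^+ 2 <= _))//.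
      by move: h; rewrite mulrBr; lra.
    by rewrite le_eqVlt; apply/orP; left; apply/eqP; field; rewrite gt_eqF.
  rewrite -/a -ler_sqr ?nnegrE ?mulr_ge0 ?rnorm_ge0// exprMn.
  case: (leP 0 (N ^+ 2 - c ^+ 2 / N ^+ 2)) => [k0|/ltW k0]; first by rewrite sqr_sqrtr.
  rewrite (le_trans h)// (@le_trans _ _ 0)//; first by rewrite mulr_le0_ge0// sqr_ge0.
  by rewrite mulr_ge0// sqr_ge0.
rewrite leNgt => /negP; apply; rewrite -[ltRHS](@ger0_norm _ N) ?(ltW N0)// -sqrtr_sqr.
by rewrite ltr_sqrt// ltrBlDr ltrDl divr_gt0// exprn_gt0.
Qed.

Lemma opnorm_poly p : let N := opnorm (poly_op p A) in
  [/\ 0 <= N, opb N (poly_op p A) & forall K, 0 <= K -> opb K (poly_op p A) -> N <= K].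
Proof.
have bp : bounded_operator (poly_op p A).
  by apply: opb_bounded; apply: (poly_op_opb _ (ltW M0) bA).
by split; [apply: opnorm_ge0|apply: opnorm_bound|move=> K; apply: opnorm_le].
Qed.

Lemma conj_horner_real p (t : R) : (map_poly Num.conj p).[t%:C] = (p.[t%:C])^*.
Proof.
have tE : Num.conj t%:C = t%:C := conjc_real t.
by rewrite -{1}tE horner_map.
Qed.

Lemma rnormM_conj (a : R[i]) : a * a^* = (rnorm a ^+ 2)%:C.
Proof. by rewrite -normCK rnormC rmorphXn. Qed.

Lemma spectrum_attained p N : 0 < N -> opb N (poly_op p A) ->
  (forall K, 0 <= K -> opb K (poly_op p A) -> N <= K) ->
  p * map_poly Num.conj p != (N ^+ 2)%:C%:P ->
  exists2 t : R, spectrum A t%:C & rnorm p.[t%:C] = N.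
Proof.
move=> N0 bP hN; rewrite -subr_eq0 => q0.
have [t st] := poly_spectrum q0 (poly_op_approx N0 bP hN).
rewrite rootE hornerD hornerN hornerC hornerM conj_horner_real subr_eq0.
rewrite rnormM_conj => /eqP/complexI/eqP.
by rewrite eqrXn2 ?rnorm_ge0 ?(ltW N0)// => /eqP; exists t.
Qed.

(** Take [p = 'X]. If [A] has norm zero, it is not bounded below; otherwise ['X^2] is not constant
    and the norm is attained on the spectrum. *)
Lemma spectrum_nonempty : (exists x : H, x != 0) -> exists t : R, spectrum A t%:C.
Proof.
move=> [x x0]; have [N0 bN leN] := opnorm_poly 'X.
set N := opnorm _ in N0 bN leN.
move: N0; rewrite le_eqVlt => /predU1P[NE|N0].
  have [||t st _] := @poly_spectrum 'X; [by rewrite polyX_eq0| |by exists t].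
  move=> [c c0 /(_ x)]; case: bN => _ /(_ x) h1 h2; have := le_trans h2 h1.
  rewrite -NE mul0r pmulr_rle0// => xle.
  by move/eqP: x0; apply; apply: rnorm_eq0; apply/eqP; rewrite eq_le xle rnorm_ge0.
have [|t st _] := spectrum_attained N0 bN leN; last by exists t.
rewrite map_polyX -expr2; apply/eqP => /(congr1 (fun q : {poly R[i]} => size q)).
by rewrite size_polyXn => h; have := size_polyC_leq1 (N ^+ 2)%:C; rewrite -h.
Qed.

(** The inequality that makes the continuous calculus possible. When [|p|^2] is the constant [N^2],
    no root argument is available, but any point of the nonempty spectrum gives the value [N]. *)
Lemma poly_op_le p (m : R) : (exists x : H, x != 0) -> 0 <= m ->
  (forall t : R, spectrum A t%:C -> rnorm p.[t%:C] <= m) -> opb m (poly_op p A).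
Proof.
move=> ne m0 hm; have [N0 bN leN] := opnorm_poly p.
apply: (opb_le _ bN); set N := opnorm _ in N0 bN leN *.
move: N0; rewrite le_eqVlt => /predU1P[<-//|N0].
have [pE|pn] := eqVneq (p * map_poly Num.conj p) (N ^+ 2)%:C%:P.
  have [t st] := spectrum_nonempty ne.
  have -> : N = rnorm p.[t%:C]; last exact: hm.
  apply/eqP; rewrite -(@eqrXn2 _ 2) ?rnorm_ge0 ?(ltW N0)//; apply/eqP/complexI.
  by rewrite -rnormM_conj -conj_horner_real -hornerM pE hornerC.
by have [t st <-] := spectrum_attained N0 bN leN pn; apply: hm.
Qed.

End Spectrum.

                                       

(** * Continuous functional calculus as a relation *)

Section Calculus.
Context {R : realType} {H : completeNormedModType R[i]}.
Variable ip : {dot H for Num.conj}.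
Hypothesis hip : hilbert_inner ip.
Hypothesis H_neq0 : exists x : H, x != 0.
Implicit Types (p q : {poly R[i]}) (phi psi : R -> R[i]) (S T : H -> H).
Variables (A : H -> H) (M : R).
Hypotheses (M0 : 0 < M) (bA : opb M A) (sA : self_adjoint ip A).

Let lA : linear A. Proof. by case: bA. Qed.

Definition close_on_spectrum (e : R) p phi :=
  forall t : R, spectrum A t%:C -> rnorm (p.[t%:C] - phi t) <= e.

                                      
(** The closure of the polynomial calculus, stated with [opb]. Being a relation, it lets operators
    be built first and identified with functions of [A] afterwards. *)
Definition calc phi S := linear S /\ forall e : R, 0 < e ->
  exists p, close_on_spectrum e p phi /\ opb e (poly_op p A \- S).

Lemma calc_opb phi S (m : R) : calc phi S -> 0 <= m ->
  (forall t : R, spectrum A t%:C -> rnorm (phi t) <= m) -> opb m S.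
Proof.
move=> [lS hS] m0 hm; split=> // x; rewrite -subr_le0.
apply: (@cvg0_le _ (2 * rnorm x) _ _ (@cvg_harmonic R)) => n.
set e := harmonic n; have e0 : 0 < e by rewrite invr_gt0.
have [p [pe [_ /(_ x) pS]]] := hS e e0.
have [_ /(_ x) hp] : opb (m + e) (poly_op p A).
  apply: (poly_op_le hip M0 bA sA H_neq0); first by rewrite addr_ge0// ltW.
  move=> t st; rewrite -(subrK (phi t) p.[_]) (le_trans (ler_rnormD _ _))//.
  by rewrite addrC lerD ?hm ?pe.
rewrite lerBlDr -(subrK (poly_op p A x) (S x)) (le_trans (ler_rnormD _ _))//.
by rewrite rnorm_distC; move: hp pS; rewrite /= mulrDl; lra.
Qed.

Lemma calc_unique phi S T : calc phi S -> calc phi T -> S = T.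
Proof.
move=> [lS hS] [lT hT]; apply/funext => x; apply/eqP; rewrite -subr_eq0.
apply/eqP/rnorm_eq0/eqP; rewrite eq_le rnorm_ge0 andbT.
apply: (@cvg0_le _ (4 * rnorm x) _ _ (@cvg_harmonic R)) => n.
set e := harmonic n; have e0 : 0 < e by rewrite invr_gt0.
have [p [pe [_ /(_ x) pS]]] := hS e e0.
have [q [qe [_ /(_ x) qT]]] := hT e e0.
have [_ /(_ x) pq] : opb (e + e) (poly_op (p - q) A).
  apply: (poly_op_le hip M0 bA sA H_neq0); first by rewrite addr_ge0// ltW.
  move=> t st; rewrite hornerD hornerN -[p.[_]](subrK (phi t)) -addrA.
  by rewrite (le_trans (ler_rnormD _ _))// lerD ?pe// rnorm_distC qe.
have -> : S x - T x = - (poly_op p A x - S x) + poly_op (p - q) A x + (poly_op q A x - T x).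
  by rewrite poly_opB opprB !addrA !subrK.
rewrite (le_trans (ler_rnormD _ _))//.
have := ler_rnormD (- (poly_op p A x - S x)) (poly_op (p - q) A x).
by rewrite rnormN; move: pS qT pq => /=; rewrite mulrDl; lra.
Qed.

Lemma calc_ext phi psi S : (forall t : R, spectrum A t%:C -> phi t = psi t) ->
  calc phi S -> calc psi S.
Proof.
move=> pp [lS hS]; split=> // e e0; have [p [pe pS]] := hS e e0.
by exists p; split=> // t st; rewrite -pp// pe.
Qed.

Lemma calc_poly p : calc (fun t => p.[t%:C]) (poly_op p A).
Proof.
split=> [|e e0]; first exact: linear_poly_op.
exists p; split=> [t _|]; first by rewrite subrr rnorm0 ltW.
apply: (opb_le (ltW e0)); rewrite (_ : _ \- _ = \0); first exact: opb_zero.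
by apply/funext => x /=; rewrite subrr.
Qed.

Lemma calc_const c : calc (fun=> c) (fun x => c *: x).
Proof.
have -> : (fun x => c *: x) = poly_op c%:P A by apply/funext => x; rewrite poly_opC.
by apply: calc_ext (calc_poly _) => t _; rewrite hornerC.
Qed.

Lemma calc_id : calc (fun t => t%:C) A.
Proof.
rewrite (_ : A = poly_op 'X A) /=; last by apply/funext => x; rewrite poly_opX.
by apply: calc_ext (calc_poly _) => t _; rewrite hornerX.
Qed.

Lemma calcD phi psi S T : calc phi S -> calc psi T ->
  calc (fun t => phi t + psi t) (S \+ T).
Proof.
move=> [lS hS] [lT hT]; split=> [a x y|e e0]; first by rewrite /= lS lT scalerDr addrACA.
have e20 : 0 < e / 2 by rewrite divr_gt0.
have [p [pe pS]] := hS _ e20; have [q [qe qT]] := hT _ e20.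
have eE : e = e / 2 + e / 2 by field.
exists (p + q); split=> [t st|].
  rewrite hornerD opprD addrACA (le_trans (ler_rnormD _ _))// eE lerD ?pe ?qe//.
rewrite eE (_ : _ \- _ = (poly_op p A \- S) \+ (poly_op q A \- T)); first exact: opbD.
by apply/funext => x /=; rewrite poly_opD opprD addrACA.
Qed.

Lemma calc_bounded phi S : calc phi S ->
  exists2 K : R, 0 < K & forall t : R, spectrum A t%:C -> rnorm (phi t) <= K.
Proof.
move=> [_ /(_ 1 ltr01)[p [pe _]]].
pose K := \sum_(i < size p) rnorm p`_i * M ^+ i.
have K0 : 0 <= K.
  by apply: sumr_ge0 => i _; rewrite mulr_ge0 ?rnorm_ge0// exprn_ge0// ltW.
exists (1 + K); first by rewrite ltr_wpDr.
move=> t st; rewrite -(subrK p.[t%:C] (phi t)) (le_trans (ler_rnormD _ _))//.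
rewrite rnorm_distC lerD ?pe// horner_coef (le_trans (ler_rnorm_sum _ _ _))//.
apply: ler_sum => i _; rewrite rnormM ler_wpM2l ?rnorm_ge0//.
rewrite -rmorphXn rnorm_real normrX lerXn2r ?nnegrE ?(ltW M0)//.
exact: (spectrum_le M0 bA).
Qed.

Lemma calcM phi psi S T : calc phi S -> calc psi T ->
  calc (fun t => phi t * psi t) (S \o T).
Proof.
move=> cS cT; have [K K0 hK] := calc_bounded cS; have [L L0 hL] := calc_bounded cT.
have [bS bT] := (calc_opb cS (ltW K0) hK, calc_opb cT (ltW L0) hL).
case: cS cT => [lS hS] [lT hT]; split=> [a x y|e e0]; first by rewrite /= lT lS.
(* The error of a product is [p (q - psi) + (p - phi) psi], with [p] bounded by [K + 1] as soon as
   [d <= 1]. *)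
pose d := Num.min 1 (e / (K + 1 + L)).
have KL0 : 0 < K + 1 + L by rewrite !addr_gt0.
have d0 : 0 < d by rewrite lt_min ltr01 divr_gt0.
have d1 : d <= 1 by rewrite ge_min lexx.
have de : (K + 1) * d + d * L <= e.
  by rewrite mulrC -mulrDr -ler_pdivlMr// ge_min lexx orbT.
have [p [pe pS]] := hS _ d0; have [q [qe qT]] := hT _ d0.
have pK t : spectrum A t%:C -> rnorm p.[t%:C] <= K + 1.
  move=> st; rewrite -(subrK (phi t) p.[_]) (le_trans (ler_rnormD _ _))//.
  by rewrite addrC lerD ?hK// (le_trans (pe _ st)).
have K10 : 0 <= K + 1 by rewrite addr_ge0// ltW.
exists (p * q); split=> [t st|].
  have -> : (p * q).[t%:C] - phi t * psi t =
    p.[t%:C] * (q.[t%:C] - psi t) + (p.[t%:C] - phi t) * psi t by rewrite hornerM; ring.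
  rewrite (le_trans (ler_rnormD _ _))// (le_trans _ de)// !rnormM.
  by rewrite lerD// ler_pM ?rnorm_ge0 ?pK ?qe ?pe ?hL.
apply: (opb_le de).
rewrite (_ : _ \- _ = (poly_op p A \o (poly_op q A \- T)) \+ ((poly_op p A \- S) \o T)).
  apply: opbD; last exact: opb_comp (ltW d0) pS bT.
  by apply: opb_comp => //; apply: (poly_op_le hip M0 bA sA H_neq0).
apply/funext => x /=.
by rewrite poly_opM// (linear_fB (linear_poly_op lA p)) addrA subrK.
Qed.

Lemma calcZ a phi S : calc phi S -> calc (fun t => a * phi t) (a \*: S).
Proof. exact: calcM (calc_const a). Qed.

Lemma calcB phi psi S T : calc phi S -> calc psi T ->
  calc (fun t => phi t - psi t) (S \- T).
Proof.
move=> cS /(calcZ (-1)) cT; have := calcD cS cT.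
rewrite (_ : S \+ _ = S \- T); last by apply/funext => x /=; rewrite scaleN1r.
by apply: calc_ext => t _; rewrite mulN1r.
Qed.

Lemma calc_sum (I : Type) (r : seq I) (phi : I -> R -> R[i]) (S : I -> H -> H) :
  (forall i, calc (phi i) (S i)) ->
  calc (fun t => \sum_(i <- r) phi i t) (fun x => \sum_(i <- r) S i x).
Proof.
move=> cS; elim: r => [|i r IH].
  have := calc_const 0; congr calc; apply/funext => x; rewrite big_nil ?scale0r//.
have := calcD (cS i) IH; congr calc; apply/funext => x; rewrite big_cons//.
Qed.

(** By [poly_op_le], uniformly close polynomials give close operators, so [p_n(A) x] is Cauchy with
    a rate proportional to the norm of [x]; the limit is therefore uniform. *)
Lemma calc_exists phi :
  (forall e : R, 0 < e -> exists p, close_on_spectrum e p phi) -> exists S, calc phi S.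
Proof.
move=> hphi; have /choice[p hp] n : exists p, close_on_spectrum (harmonic n) p phi.
  by apply: hphi; rewrite invr_gt0.
have hn0 n : 0 < harmonic n :> R by rewrite invr_gt0.
have mono n m : (n <= m)%N -> harmonic m <= harmonic n :> R.
  by move=> nm; rewrite lef_pV2 ?posrE// ler_nat.
have cau n m x : (n <= m)%N ->
    rnorm (poly_op (p m) A x - poly_op (p n) A x) <= 2 * rnorm x * harmonic n.
  move=> nm; have [_ /(_ x)] : opb (2 * harmonic n) (poly_op (p m - p n) A).
    apply: (poly_op_le hip M0 bA sA H_neq0); first by rewrite mulr_ge0// ltW.
    move=> t st; rewrite hornerD hornerN -[(p m).[_]](subrK (phi t)) -addrA.
    rewrite (le_trans (ler_rnormD _ _))// mulr_natl mulr2n lerD//; last first.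
      by rewrite rnorm_distC hp.
    by rewrite (le_trans _ (mono _ _ nm))// hp.
  by rewrite poly_opB mulrAC.
have /choice[S hS] x : exists y, forall n,
    rnorm (y - poly_op (p n) A x) <= 2 * rnorm x * harmonic n.
  apply: (@rnorm_complete _ _ (fun n => poly_op (p n) A x)); last by move=> n m; exact: cau.
  by rewrite -[0](mulr0 (2 * rnorm x)); apply: cvgMr; exact: cvg_harmonic.
have lS : linear S.
  move=> a x y; apply/eqP; rewrite -subr_eq0.
  apply/eqP/rnorm_eq0/eqP; rewrite eq_le rnorm_ge0 andbT.
  apply: (@cvg0_le _ (2 * rnorm (a *: x + y) + rnorm a * (2 * rnorm x) + 2 * rnorm y)
    _ _ (@cvg_harmonic R)) => n.
  have -> : S (a *: x + y) - (a *: S x + S y) =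
     (S (a *: x + y) - poly_op (p n) A (a *: x + y))
     - a *: (S x - poly_op (p n) A x) - (S y - poly_op (p n) A y).
    rewrite linear_poly_op// scalerBr -[RHS]addrA -[in RHS]opprD.
    by rewrite [in RHS]addrACA -[in RHS](opprD (a *: _)) opprB addrA subrK.
  rewrite mulrDl (le_trans (ler_rnormB _ _))// lerD ?hS//.
  rewrite mulrDl (le_trans (ler_rnormB _ _))// lerD ?hS// rnormZ -mulrA.
  by rewrite ler_wpM2l ?rnorm_ge0.
exists S; split=> // e e0.
have [N _ /(_ N (leqnn N)) /= hN] : \forall n \near \oo, harmonic n < e / 2 :> R.
  by apply: cvgr_lt (@cvg_harmonic R) _ _; rewrite divr_gt0.
exists (p N); split=> [t st|].
  by rewrite (le_trans (hp _ _ st))// (le_trans (ltW hN))// ler_pdivrMr// ler_peMr ?ltW// ltr1n.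
split=> [a x y|x] /=.
  by rewrite linear_poly_op// lS scalerBr opprD addrACA.
rewrite rnorm_distC (le_trans (hS _ _))// mulrAC ler_wpM2r ?rnorm_ge0//.
by rewrite mulrC -ler_pdivlMr// ltW.
Qed.

Lemma calc_exists_quad phi :
  (forall e : R, 0 < e -> exists C : R, forall x y, `|x| <= M -> `|y| <= M ->
    rnorm (phi x - phi y) <= e + C * (x - y) ^+ 2) ->
  exists S, calc phi S.
Proof.
move=> /(Weierstrass M0) h; apply: calc_exists => e /h[p hp].
by exists p => t st; apply: hp; apply: (spectrum_le M0 bA).
Qed.

Lemma calc_lipschitz phi (L : R) :
  (forall x y, rnorm (phi x - phi y) <= L * `|x - y|) -> exists S, calc phi S.
Proof.
move=> hL; apply: calc_exists_quad => e e0; exists (L ^+ 2 / e) => x y _ _.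
rewrite (le_trans (hL _ _))// -[(x - y) ^+ 2]real_normK ?num_real//.
set d := `|x - y|; rewrite -subr_ge0.
(* Completing the square turns the Lipschitz bound [L d] into the quadratic form required by
   [Weierstrass]. *)
have -> : e + L ^+ 2 / e * d ^+ 2 - L * d = ((L * d - e / 2) ^+ 2 + 3 / 4 * e ^+ 2) / e.
  by field; rewrite gt_eqF.
by rewrite divr_ge0 ?(ltW e0)// addr_ge0 ?sqr_ge0// mulr_ge0 ?sqr_ge0.
Qed.

(** The adjoint of [phi(A)] is the conjugate function of [A]. One inequality is obtained in the
    limit; applying it to [- x] gives equality. *)
Lemma calc_conj phi S : calc phi S -> exists2 S', calc (fun t => Num.conj (phi t)) S' &
  forall x y, rip ip (S x) y = rip ip x (S' y).
Proof.
move=> cS; have conjP e p : close_on_spectrum e p phi ->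
    close_on_spectrum e (map_poly Num.conj p) (fun t => Num.conj (phi t)).
  move=> pe t st; rewrite conj_horner_real -rmorphB.
  by rewrite [X in X <= _]rnorm_conj pe.
have [|S' cS'] := @calc_exists (fun t => Num.conj (phi t)).
  move=> e e0; have [_ /(_ e e0)[p [pe _]]] := cS.
  by exists (map_poly Num.conj p); apply: conjP.
have le0 x y : rip ip (S x) y - rip ip x (S' y) <= 0.
  apply: (@cvg0_le _ (2 * (rnorm x * rnorm y)) _ _ (@cvg_harmonic R)) => n.
  set e := harmonic n; have e0 : 0 < e by rewrite invr_gt0.
  have [lS /(_ e e0)[p [pe [_ /(_ x) pS]]]] := cS.
  pose p' := map_poly Num.conj p.
  have [_ /(_ y) pS'] : opb e (poly_op p' A \- S').
    by apply: (calc_opb (calcB (calc_poly p') cS') (ltW e0)) => t st; apply: conjP.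
  have -> : rip ip (S x) y - rip ip x (S' y) =
      rip ip x ((poly_op p' A \- S') y) - rip ip ((poly_op p A \- S) x) y.
    have adj : rip ip (poly_op p A x) y = rip ip x (poly_op p' A y).
      by rewrite /rip poly_op_adj.
    by rewrite /= ripDl ripDr ripNl ripNr adj; ring.
  rewrite -ripNl -mulrA mulr_natl mulr2n lerD// (le_trans (rip_le hip _ _))//.
    by rewrite -mulrA ler_wpM2l ?rnorm_ge0// mulrC.
  by rewrite rnormN mulrAC ler_wpM2r ?rnorm_ge0// mulrC.
exists S' => // x y; have [lS _] := cS.
by have := le0 x y; have := le0 (- x) y; rewrite linear_fN// !ripNl; lra.
Qed.

(** Existence makes [xget] return a genuine value, and that value satisfies [calc], so every rule
    above applies to [fun_calc]. *)
Lemma calc_fun_calc phi S : calc phi S -> calc phi (fun_calc phi A).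
Proof.
move=> cS.
have /(xgetPex (\0 : H -> H)) : exists S, is_fun_calc phi A S.
  have [K K0 hK] := calc_bounded cS.
  exists S; split; first exact: opb_bounded (calc_opb cS (ltW K0) hK).
  have hn0 n : 0 < harmonic n :> R by rewrite invr_gt0.
  have [lS hS] := cS; have /choice[p hp] n := hS _ (hn0 n).
  exists p; split.
    move=> e e0; have : \forall n \near \oo, harmonic n < e.
      by apply: cvgr_lt (@cvg_harmonic R) _ e0.
    apply: filterS => n ne t st.
    by rewrite (le_lt_trans _ ne)//; apply: (hp n).1.
  have pS n : opb (harmonic n) (S \- poly_op (p n) A).
    have := opbN (hp n).2; congr opb; apply/funext => x /=; exact: opprB.
  apply: (squeeze_cvgr _ (cvg_cst 0) (@cvg_harmonic R)).
  apply: nearW => n; rewrite opnorm_ge0 ?opnorm_le ?(ltW (hn0 n))//.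
  exact: opb_bounded (pS n).
rewrite -/(fun_calc phi A) => -[[lF bF] [p [pphi pF]]]; split=> // e e0.
have [N _ hN] := pphi e e0.
have [N' _ hN'] : \forall n \near \oo, opnorm (fun_calc phi A \- poly_op (p n) A) < e.
  by apply: cvgr_lt pF _ e0.
pose n := maxn N N'.
exists (p n); split=> [t st|]; first by apply/ltW/hN => //=; rewrite leq_maxl.
have /= /ltW ne := hN' n (leq_maxr _ _).
have bp : bounded_operator (poly_op (p n) A).
  by apply: opb_bounded; apply: (poly_op_opb _ (ltW M0) bA).
have [K _ bK] := bounded_opb bp.
have [L _ bL] := @bounded_opb _ _ (fun_calc phi A) (conj lF bF).
have := opbN (opb_le ne (opnorm_bound (opb_bounded (opbB bL bK)))).
by congr opb; apply/funext => x /=; exact: opprB.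
Qed.

End Calculus.

                       

(** * Scalar inequalities: Cauchy-Schwarz, tents, a lattice sum *)

Section Scalar.
Context {R : realType}.
Implicit Types (s x y : R).

(** Cauchy-Schwarz from the weighted arithmetic-geometric inequality. The bounds are enlarged by [e]
    so that the weights [b / a] and [a / b] make sense even when [p] or [q] is zero. *)
Lemma ler_sum_mul (I : Type) (r : seq I) (x y : I -> R) (p q : R) : 0 <= p -> 0 <= q ->
  \sum_(i <- r) x i ^+ 2 <= p ^+ 2 -> \sum_(i <- r) y i ^+ 2 <= q ^+ 2 ->
  \sum_(i <- r) x i * y i <= p * q.
Proof.
move=> p0 q0 hx hy; rewrite -subr_le0.
apply: (@cvg0_le _ (p + q + 1) _ _ (@cvg_harmonic R)) => n.
set e := harmonic n; have e0 : 0 < e by rewrite invr_gt0.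
have e1 : e <= 1 by rewrite invf_le1 ?ltr0n// ler1n.
pose a := p + e; pose b := q + e.
have a0 : 0 < a by rewrite ltr_wpDl.
have b0 : 0 < b by rewrite ltr_wpDl.
have : \sum_(i <- r) x i * y i <=
    \sum_(i <- r) (b / a / 2 * x i ^+ 2 + a / b / 2 * y i ^+ 2).
  apply: ler_sum => i _; rewrite -subr_ge0.
  have -> : b / a / 2 * x i ^+ 2 + a / b / 2 * y i ^+ 2 - x i * y i =
     (b * x i - a * y i) ^+ 2 / (2 * a * b) by field; rewrite !gt_eqF.
  by rewrite divr_ge0 ?sqr_ge0// !mulr_ge0 ?ltW.
rewrite big_split/= -!mulr_sumr.
have hp : p ^+ 2 <= a ^+ 2 by rewrite lerXn2r ?nnegrE ?(ltW a0)// lerDl ltW.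
have hq : q ^+ 2 <= b ^+ 2 by rewrite lerXn2r ?nnegrE ?(ltW b0)// lerDl ltW.
have ba : 0 <= b / a / 2 by rewrite !divr_ge0 ?ltW.
have ab : 0 <= a / b / 2 by rewrite !divr_ge0 ?ltW.
have h1 := ler_wpM2l ba (le_trans hx hp).
have h2 := ler_wpM2l ab (le_trans hy hq).
move=> /le_trans /(_ (lerD h1 h2)).
have -> : b / a / 2 * a ^+ 2 + a / b / 2 * b ^+ 2 = a * b by field; rewrite !gt_eqF.
rewrite lerBlDr => /le_trans; apply.
have : e * e <= e by rewrite ler_piMr// ltW.
by rewrite /a /b; lra.
Qed.

Definition clamp01 s : R := Num.min 1 (Num.max 0 s).

Lemma clamp01_ge1 s : 1 <= s -> clamp01 s = 1.
Proof. by move=> s1; rewrite /clamp01 max_r ?min_l// (le_trans ler01). Qed.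

Lemma clamp01_le0 s : s <= 0 -> clamp01 s = 0.
Proof. by move=> s0; rewrite /clamp01 max_l// min_r. Qed.

Lemma clamp01_id s : 0 <= s <= 1 -> clamp01 s = s.
Proof. by case/andP=> s0 s1; rewrite /clamp01 max_r// min_r. Qed.

Lemma clamp01_lip x y : `|clamp01 x - clamp01 y| <= `|x - y|.
Proof.
wlog xy : x y / x <= y.
  by move=> h; have [/h//|/ltW/h] := leP x y; rewrite distrC (distrC x).
rewrite distrC (distrC x) ![`|_|]ger0_norm ?subr_ge0//; last first.
  by rewrite /clamp01 le_min ge_min lexx/= ge_min ge_max !le_max lexx xy !orbT.
have [x0|x0] := leP x 0; have [y0|y0] := leP y 0;
have [x1|x1] := leP 1 x; have [y1|y1] := leP 1 y;
rewrite ?(clamp01_ge1 x1) ?(clamp01_ge1 y1) ?(clamp01_le0 x0) ?(clamp01_le0 y0);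
rewrite ?clamp01_id ?(ltW x0) ?(ltW y0) ?(ltW x1) ?(ltW y1)//; lra.
Qed.

                                                                     
                
(** The function [max(0, 1 - |s|)], written as a difference of clamps so that the sum over integer
    translates telescopes to one. *)
Definition tent s : R := clamp01 (s + 1) - clamp01 s.

Lemma tentP s : [/\ 0 <= tent s, tent s <= 1 & tent s != 0 -> `|s| <= 1].
Proof.
rewrite /tent; have [s1|s1] := leP 1 s.
  rewrite !clamp01_ge1 ?subrr ?eqxx ?ler01//; lra.
have [s0|s0] := leP 0 s.
  rewrite clamp01_ge1 ?clamp01_id ?s0 ?(ltW s1)//; last by lra.
  by split; [lra|lra|move=> _; rewrite ger0_norm// ltW].
have [s2|s2] := leP s (-1).
  rewrite !clamp01_le0 ?subrr ?eqxx ?ler01//; lra.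
rewrite (clamp01_le0 (ltW s0)) clamp01_id; last by apply/andP; lra.
by split; [lra|lra|move=> _; rewrite ltr0_norm//; lra].
Qed.

Lemma tent_lip x y : `|tent x - tent y| <= 2 * `|x - y|.
Proof.
have -> : tent x - tent y = (clamp01 (x + 1) - clamp01 (y + 1)) - (clamp01 x - clamp01 y).
  by rewrite /tent; ring.
rewrite (le_trans (ler_normB _ _))// mulr_natl mulr2n lerD// ?clamp01_lip//.
by rewrite (le_trans (clamp01_lip _ _))// opprD addrACA subrr addr0.
Qed.

Lemma sum_tent n x : `|x| <= n%:R ->
  \sum_(0 <= j < (2 * n).+1) tent (x - (j%:R - n%:R)) = 1.
Proof.
move=> xn; move: (xn); rewrite ler_norml => /andP[x1 x2].
pose c j := - clamp01 (x - (j%:R - n%:R) + 1).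
rewrite (eq_bigr (fun j => c j.+1 - c j)) => [|j _]; last first.
  rewrite /c /tent opprK addrC -natr1; congr (- clamp01 _ + _); ring.
rewrite telescope_sumr// /c -natr1 natrM.
rewrite clamp01_le0 ?clamp01_ge1 ?opprK; lra.
Qed.

                                                                      
Lemma sum_inv_sqr n x : \sum_(0 <= j < n) (1 + (x - j%:R) ^+ 2)^-1 <= 8.
Proof.
(* A bounded function whose increment over a unit step dominates [1 / (4 (1 + s^2))]; the lattice
   sum telescopes to at most 4 times the oscillation 2 of [g]. *)
pose g s : R := s / (1 + `|s|).
have g1 s : `|g s| <= 1.
  by rewrite normrM normfV ler_pdivrMr ?normr_gt0 ?gt_eqF ?ltr_wpDr// mul1r
    (le_trans _ (ler_norm _))// lerDr.
have gS s : (1 + s ^+ 2)^-1 <= 4 * (g (s + 1) - g s).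
  have d0 : 0 < 1 + s ^+ 2 by rewrite ltr_pwDl// sqr_ge0.
  rewrite -subr_ge0 /g; have [s0|s0] := leP 0 s.
    rewrite !ger0_norm//; last by lra.
    have -> : 4 * ((s + 1) / (1 + (s + 1)) - s / (1 + s)) - (1 + s ^+ 2)^-1 =
        (3 * (s - 1 / 2) ^+ 2 + 5 / 4) / ((1 + (s + 1)) * (1 + s) * (1 + s ^+ 2)).
      by field; rewrite ?gt_eqF//; lra.
    by rewrite divr_ge0 ?mulr_ge0 ?(ltW d0)//; have := sqr_ge0 (s - 1 / 2); lra.
  rewrite (ltr0_norm s0); have [s1|s1] := leP s (-1).
    rewrite ler0_norm; last by lra.
    have -> : 4 * ((s + 1) / (1 - (s + 1)) - s / (1 - s)) - (1 + s ^+ 2)^-1 =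
        (5 / 2 * s ^+ 2 + (s + 1) ^+ 2 / 2 + 7 / 2) / (- s * (1 - s) * (1 + s ^+ 2)).
      by field; rewrite (lt_eqF s0) !gt_eqF//; lra.
    rewrite divr_ge0 ?mulr_ge0 ?(ltW d0)//; try lra.
    by have := sqr_ge0 s; have := sqr_ge0 (s + 1); lra.
  rewrite gtr0_norm; last by lra.
  have -> : 4 * ((s + 1) / (1 + (s + 1)) - s / (1 - s)) - (1 + s ^+ 2)^-1 =
      (2 + 4 * - s + 3 * (- s * (1 + s)) + 8 * (s ^+ 2 * (- s * (1 + s)))) /
      ((1 + (s + 1)) * (1 - s) * (1 + s ^+ 2)).
    by field; rewrite ?gt_eqF//; lra.
  have s2 : 0 <= - s * (1 + s) by apply: mulr_ge0; lra.
  have := mulr_ge0 (sqr_ge0 s) s2. move=> s3.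
  by rewrite divr_ge0 ?mulr_ge0 ?(ltW d0)//; lra.
apply: (@le_trans _ _ (\sum_(0 <= j < n) 4 * (- g (x - j.+1%:R + 1) - - g (x - j%:R + 1)))).
  apply: ler_sum => j _; rewrite (le_trans (gS _))// ler_pM2l// opprK addrC.
  by rewrite -natr1 opprD addrA subrK.
rewrite -mulr_sumr telescope_sumr//.
have := g1 (x - n%:R + 1); have := g1 (x - 0%:R + 1).
by rewrite !ler_norml => /andP[? ?] /andP[? ?]; lra.
Qed.

End Scalar.

(** * Operator sums bounded through square functions *)

Section Multipliers.
Context {R : realType} {H : completeNormedModType R[i]}.
Variable ip : {dot H for Num.conj}.
Hypothesis hip : hilbert_inner ip.
Hypothesis H_neq0 : exists x : H, x != 0.
Variable M : R.
Hypothesis M0 : 0 < M.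
Implicit Types (S T Y : H -> H).

(** The sum is the quadratic form of the sum of the [S_i^* S_i], which is the function
    [sum |phi_i|^2] of [A]. *)
Lemma calc_sum_sqr A (I : Type) (r : seq I) (phi : I -> R -> R[i]) (S : I -> H -> H) k :
  opb M A -> self_adjoint ip A -> (forall i, calc A (phi i) (S i)) -> 0 <= k ->
  (forall t : R, spectrum A t%:C -> \sum_(i <- r) rnorm (phi i t) ^+ 2 <= k ^+ 2) ->
  forall u, \sum_(i <- r) rnorm (S i u) ^+ 2 <= (k * rnorm u) ^+ 2.
Proof.
move=> bA sA cS k0 hk u.
have /choice[S' hS'] i : exists S', calc A (fun t => Num.conj (phi i t)) S' /\
    forall x y, rip ip (S i x) y = rip ip x (S' y).
  by have [S' c a] := calc_conj hip H_neq0 M0 bA sA (cS i); exists S'.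
pose Q x := \sum_(i <- r) S' i (S i x).
have cQ : calc A (fun t => \sum_(i <- r) Num.conj (phi i t) * phi i t) Q.
  apply: (calc_sum bA r (phi := fun i t => Num.conj (phi i t) * phi i t)
    (S := fun i x => S' i (S i x))).
  by move=> i; apply: (calcM hip H_neq0 M0 bA sA (hS' i).1 (cS i)).
have [_ /(_ u) bQ] : opb (k ^+ 2) Q.
  apply: (calc_opb hip H_neq0 M0 bA sA cQ (sqr_ge0 _)) => t st.
  rewrite (le_trans (ler_rnorm_sum _ _ _))// (le_trans _ (hk t st))//.
  by apply: ler_sum => i _; rewrite rnormM rnorm_conj.
have -> : \sum_(i <- r) rnorm (S i u) ^+ 2 = rip ip (Q u) u.
  rewrite rip_suml; apply: eq_bigr => i _.
  by rewrite -(rip_norm hip) (hS' i).2 ripC.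
rewrite (le_trans (rip_le hip _ _))// exprMn [rnorm u ^+ 2]expr2 mulrA.
by rewrite ler_wpM2r ?rnorm_ge0.
Qed.

(** A Schur multiplier bound for the symbol [sum_i a_i(x) b_i(y)]: the squared norm of [v] is a sum
    of pairings of [Y G_i u] with [F_i^* v], and Cauchy-Schwarz over [i] applies to both
    families. *)
Lemma calc_multiplier A B (I : Type) (r : seq I) (a b : I -> R -> R[i])
    (F G : I -> H -> H) ka kb eta Y :
  opb M A -> self_adjoint ip A -> opb M B -> self_adjoint ip B ->
  (forall i, calc A (a i) (F i)) -> (forall i, calc B (b i) (G i)) ->
  0 <= ka -> 0 <= kb -> 0 <= eta -> opb eta Y ->
  (forall t : R, spectrum A t%:C -> \sum_(i <- r) rnorm (a i t) ^+ 2 <= ka ^+ 2) ->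
  (forall t : R, spectrum B t%:C -> \sum_(i <- r) rnorm (b i t) ^+ 2 <= kb ^+ 2) ->
  forall u, rnorm (\sum_(i <- r) F i (Y (G i u))) <= ka * kb * eta * rnorm u.
Proof.
move=> bA sA bB sB cF cG ka0 kb0 eta0 [lY bY] ha hb u.
set v := \sum_(i <- r) _.
have /choice[F' hF'] i : exists S', calc A (fun t => Num.conj (a i t)) S' /\
    forall x y, rip ip (F i x) y = rip ip x (S' y).
  by have [S' c d] := calc_conj hip H_neq0 M0 bA sA (cF i); exists S'.
have hF2 : \sum_(i <- r) rnorm (F' i v) ^+ 2 <= (ka * rnorm v) ^+ 2.
  apply: (calc_sum_sqr bA sA (fun i => (hF' i).1)) => // t st.
  by under eq_bigr do rewrite rnorm_conj; apply: ha.
have hG2 := calc_sum_sqr bB sB cG kb0 hb u.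
have vv : rnorm v ^+ 2 <= eta * ((ka * rnorm v) * (kb * rnorm u)).
  rewrite -(rip_norm hip) {1}/v rip_suml.
  apply: (@le_trans _ _ (eta * \sum_(i <- r) rnorm (F' i v) * rnorm (G i u))); last first.
    by rewrite ler_wpM2l// ler_sum_mul// mulr_ge0 ?rnorm_ge0.
  rewrite mulr_sumr; apply: ler_sum => i _; rewrite (hF' i).2.
  rewrite (le_trans (rip_le hip _ _))// [leRHS]mulrCA mulrC.
  by rewrite ler_wpM2l ?rnorm_ge0.
have := rnorm_ge0 v; rewrite le_eqVlt => /predU1P[<-|v0].
  by rewrite !mulr_ge0 ?rnorm_ge0.
by rewrite -(ler_pM2r v0); move: vv; rewrite expr2; lra.
Qed.

End Multipliers.

(** * The commutator estimate at a single scale *)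

Section Local.
Context {R : realType} {H : completeNormedModType R[i]}.
Variable ip : {dot H for Num.conj}.
Hypothesis hip : hilbert_inner ip.
Hypothesis H_neq0 : exists x : H, x != 0.
Variables (M : R) (A B : H -> H).
Hypothesis M0 : 0 < M.
Hypotheses (bA : opb M A) (sA : self_adjoint ip A).
Hypotheses (bB : opb M B) (sB : self_adjoint ip B).
Variables (f : R -> R[i]) (FA FB : H -> H) (w h : R).
Hypotheses (cFA : calc A f FA) (cFB : calc B f FB).
Hypotheses (w0 : 0 <= w) (h0 : 0 < h).
Hypothesis hf : forall x y, rnorm (f x - f y) <= w * (1 + `|x - y| / h).

(** The nodes at spacing [h] cover [[-M, M]]. [X j t] is the signed distance of [t] to a node in
    units of [h], and [li j] is [X j - i], which never vanishes on the reals. Since [f - f(node)]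
    may grow linearly in [X j], two factors [rho j] are needed to make [g j] square summable over
    [j]. *)
Let n := (Num.truncn (M / h)).+1.
Let r := index_iota 0 (2 * n).+1.
Let node j : R := (j%:R - n%:R) * h.
Let X j t : R := t / h - (j%:R - n%:R).
Let al j t : R[i] := (tent (X j t))%:C.
Let c j : R[i] := (j%:R - n%:R) +i* 1.
Let li j t : R[i] := (h^-1)%:C * t%:C - c j.
Let rho j t : R[i] := (li j t)^-1.
Let g j t : R[i] := (f t - f (node j)) * (rho j t * rho j t).

Let liE j t : li j t = X j t -i* 1.
Proof. by rewrite /li /X /c; simpc; rewrite mulrC. Qed.

Let li_norm j t : rnorm (li j t) ^+ 2 = 1 + X j t ^+ 2.
Proof. by rewrite liE rnorm_sqr/= sqrrN expr1n addrC. Qed.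

Let li_neq0 j t : li j t != 0.
Proof. by rewrite liE eq_complex/= oppr_eq0 oner_eq0 andbF. Qed.

Let rho_norm j t : rnorm (rho j t) ^+ 2 = (1 + X j t ^+ 2)^-1.
Proof.
by rewrite /rho rnormV exprVn li_norm.
Qed.

Let sum_al (t : R) : `|t| <= M -> \sum_(j <- r) tent (X j t) = 1.
Proof.
move=> tM; rewrite /r /X; apply: sum_tent.
rewrite normrM normfV (gtr0_norm h0) (le_trans _ (ltW (truncnS_gt _)))//.
by rewrite ler_wpM2r// invr_ge0 ltW.
Qed.

Let al_bound j t k : (k <= 2)%N ->
  rnorm (al j t) ^+ 2 * (1 + X j t ^+ 2) ^+ k <= 4 * tent (X j t).
Proof.
move=> k2; rewrite rnorm_real; have [t0 t1 tX] := tentP (X j t).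
have [->|/tX X1] := eqVneq (tent (X j t)) 0; first by rewrite normr0 expr0n/= mul0r mulr0.
have {}X1 : X j t ^+ 2 <= 1 by rewrite -real_normK ?num_real// expr_le1.
have X2 : 0 <= X j t ^+ 2 := sqr_ge0 _.
have Xk : (1 + X j t ^+ 2) ^+ k <= 4.
  apply: (@le_trans _ _ (2 ^+ k)); last first.
    by have -> : 4 = 2 ^+ 2 :> R; [rewrite -natrX|rewrite ler_weXn2l// ler1n].
  by rewrite lerXn2r ?nnegrE ?addr_ge0//; lra.
rewrite ger0_norm// mulrC; apply: ler_pM => //; last by rewrite expr2 ler_piMl.
  by rewrite exprn_ge0// addr_ge0.
by rewrite sqr_ge0.
Qed.

Let sum_bound k (t : R) : (k <= 2)%N -> `|t| <= M ->
  \sum_(j <- r) rnorm (al j t) ^+ 2 * (1 + X j t ^+ 2) ^+ k <= 2 ^+ 2.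
Proof.
move=> k2 tM; apply: (@le_trans _ _ (\sum_(j <- r) 4 * tent (X j t))).
  by apply: ler_sum => j _; apply: al_bound.
by rewrite -mulr_sumr sum_al// mulr1 -natrX.
Qed.

Let hf' j t : rnorm (f t - f (node j)) <= w * (1 + `|X j t|).
Proof.
rewrite (le_trans (hf _ _))// ler_wpM2l// lerD2l.
rewrite -{1}(gtr0_norm h0) -normfV -normrM /X /node mulrBl mulfK// gt_eqF//.
Qed.

Let sum_g (t : R) : \sum_(j <- r) rnorm (g j t) ^+ 2 <= (4 * w) ^+ 2.
Proof.
(* The four powers of [rho] give [(1 + X^2)^-2], and [(1 + |X|)^2 <= 2 (1 + X^2)] uses up one
   factor; [sum_inv_sqr] then yields [2 * 8 * w^2]. *)
apply: (@le_trans _ _ (\sum_(j <- r) 2 * w ^+ 2 * (1 + X j t ^+ 2)^-1)).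
  apply: ler_sum => j _; have X1 : 0 < 1 + X j t ^+ 2 by rewrite ltr_pwDl// sqr_ge0.
  rewrite /g !rnormM -expr2 exprMn rho_norm [_^-1 ^+ 2]expr2 mulrA ler_wpM2r ?invr_ge0 ?(ltW X1)//.
  rewrite ler_pdivrMr//.
  have := hf' j t; rewrite -ler_sqr ?nnegrE ?rnorm_ge0// ?mulr_ge0 ?addr_ge0//.
  rewrite exprMn => /le_trans; apply.
  rewrite [2 * _]mulrC -[leRHS]mulrA ler_wpM2l ?sqr_ge0//.
  by have := sqr_ge0 (1 - `|X j t|); rewrite -[X j t ^+ 2]real_normK ?num_real//; lra.
rewrite -mulr_sumr; have := sum_inv_sqr (2 * n).+1 (t / h + n%:R).
have -> : \sum_(0 <= j < (2 * n).+1) (1 + (t / h + n%:R - j%:R) ^+ 2)^-1 =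
    \sum_(j <- r) (1 + X j t ^+ 2)^-1.
  by apply: eq_bigr => j _; rewrite /X opprB addrA.
by move=> /(ler_wpM2l (sqr_ge0 w)); lra.
Qed.

Let P (T : H -> H) j x := (h^-1)%:C *: T x - c j *: x.

Let cPA j : calc A (li j) (P A j).
Proof.
exact: (calcB hip H_neq0 M0 bA sA (calcZ hip H_neq0 M0 bA sA _ (calc_id bA)) (calc_const bA _)).
Qed.

Let cPB j : calc B (li j) (P B j).
Proof.
exact: (calcB hip H_neq0 M0 bB sB (calcZ hip H_neq0 M0 bB sB _ (calc_id bB)) (calc_const bB _)).
Qed.

Let X_lip j x y : `|X j x - X j y| = h^-1 * `|x - y|.
Proof.
have -> : X j x - X j y = h^-1 * (x - y) by rewrite /X; ring.
by rewrite normrM gtr0_norm// invr_gt0.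
Qed.

Let cE j : exists E, calc A (al j) E.
Proof.
apply: (calc_lipschitz (L := 2 / h) hip H_neq0 M0 bA sA) => x y.
by rewrite -rmorphB rnorm_real (le_trans (tent_lip _ _))// X_lip mulrA.
Qed.

Let cRho j : exists T, calc B (rho j) T.
Proof.
apply: (calc_lipschitz (L := h^-1) hip H_neq0 M0 bB sB) => x y.
have rho1 t : rnorm (rho j t) <= 1.
  rewrite -(@expr_le1 _ 2) ?rnorm_ge0// rho_norm invf_le1 ?ltr_pwDl ?sqr_ge0//.
  by rewrite lerDl sqr_ge0.
have -> : rho j x - rho j y = (X j y - X j x)%:C * (rho j x * rho j y).
  have -> : (X j y - X j x)%:C = li j y - li j x.
    by rewrite !liE; apply/eqP; rewrite eq_complex/= opprK addNr !eqxx.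
  by rewrite /rho; field; rewrite !li_neq0.
rewrite !rnormM rnorm_real X_lip distrC -[leRHS]mulr1 ler_wpM2l//.
  by rewrite mulr_ge0// invr_ge0 ltW.
by rewrite -[leRHS]mulr1 ler_pM ?rnorm_ge0.
Qed.

(** With [E_j] the tents of [A], which sum to the identity on [H], insert [f(node)] on both sides:
    the part in [f(A) - f(node)] is local and costs [2 w], while the part in [f(B) - f(node)]
    becomes four multiplier sums of norm at most [8 w eta] each. Hence [34 = 2 + 4 * 8]. *)
Lemma local_commutator eta Y Y1 Y2 : 0 <= eta ->
  opb eta Y -> opb eta Y1 -> opb eta Y2 ->
  (forall u, Y1 u = (h^-1)%:C *: (A (Y u) - Y (B u))) ->
  (forall u, Y2 u = (h^-1)%:C *: (A (Y1 u) - Y1 (B u))) ->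
  forall u, rnorm (FA (Y u) - Y (FB u)) <= 34 * w * eta * rnorm u.
Proof.
move=> eta0 bY bY1 bY2 hY1 hY2 u.
have [E hE] := choice cE; have [T hT] := choice cRho.
have [[lA _] [lY _]] := (bA, bY); have [lY1 _] := bY1.
have M_spec (C : H -> H) t : opb M C -> spectrum C t%:C -> `|t| <= M.
  by move=> bC; apply: (spectrum_le M0 bC).
pose D j := fun x => FB x - f (node j) *: x.
pose G j := D j \o (T j \o T j).
have cD j : calc B (fun t => f t - f (node j)) (D j).
  exact: (calcB hip H_neq0 M0 bB sB cFB (calc_const bB _)).
have cG j : calc B (g j) (G j).
  exact: (calcM hip H_neq0 M0 bB sB (cD j) (calcM hip H_neq0 M0 bB sB (hT j) (hT j))).
have DE j x : D j x = P B j (P B j (G j x)).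
  have h2 := calcM hip H_neq0 M0 bB sB (cPB j) (calcM hip H_neq0 M0 bB sB (cPB j) (cG j)).
  suff -> : D j = P B j \o (P B j \o G j) by [].
  apply: (calc_unique hip H_neq0 M0 bB sB (cD j)); apply: calc_ext h2 => t _.
  by rewrite /g /rho; field; rewrite li_neq0.
(* Moving one affine factor from [B] to [A] produces a scaled commutator; the constant [c j]
   cancels. *)
have YP (Z Z1 : H -> H) j x : linear Z -> (forall u, Z1 u = (h^-1)%:C *: (A (Z u) - Z (B u))) ->
    Z (P B j x) = P A j (Z x) - Z1 x.
  move=> lZ ->; rewrite /P (linear_fB lZ) !(linear_fZ lZ) scalerBr opprB.
  by rewrite [RHS]addrC addrA subrK.
have lP j : linear (P A j) by have [] := cPA j.
have lE j : linear (E j) by have [] := hE j.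
have YD j : Y (D j u) = P A j (P A j (Y (G j u))) - P A j (Y1 (G j u))
    - (P A j (Y1 (G j u)) - Y2 (G j u)).
  by rewrite DE (YP Y Y1)// (YP Y Y1)// (YP Y1 Y2)// (linear_fB (lP j)).
have sumE z : \sum_(j <- r) E j z = z.
  have cS := calc_sum bA r hE.
  suff -> : (\sum_(j <- r) E j z) = 1 *: z by rewrite scale1r.
  suff /(congr1 (@^~ z)) : (fun z => \sum_(j <- r) E j z) = (fun z => 1 *: z) by [].
  apply: (calc_unique hip H_neq0 M0 bA sA _ (calc_const bA 1)).
  apply: calc_ext cS => t st; rewrite -rmorph_sum/=.
  by rewrite sum_al ?rmorph1//; apply: M_spec st.
pose F1 x := \sum_(j <- r) E j (FA x - f (node j) *: x).
(* On the support of a tent [|X j| <= 1], so [f] is within [2 w] of its value at the node, and the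
   tents have total weight one. *)
have bF1 : opb (2 * w) F1.
  have cF1 : calc A (fun t => \sum_(j <- r) al j t * (f t - f (node j))) F1.
    apply: (calc_sum bA r (S := fun j x => E j (FA x - f (node j) *: x))
      (phi := fun j t => al j t * (f t - f (node j)))) => j.
    apply: (calcM hip H_neq0 M0 bA sA (hE j)).
    exact: (calcB hip H_neq0 M0 bA sA cFA (calc_const bA _)).
  apply: (calc_opb hip H_neq0 M0 bA sA cF1); first by rewrite mulr_ge0.
  move=> t st; rewrite (le_trans (ler_rnorm_sum _ _ _))//.
  have <- : 2 * w * (\sum_(j <- r) tent (X j t)) = 2 * w.
    by rewrite sum_al ?mulr1//; apply: M_spec st.
  rewrite mulr_sumr.
  apply: ler_sum => j _; rewrite rnormM rnorm_real.
  have [t0 t1 tX] := tentP (X j t).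
  have [->|/tX X1] := eqVneq (tent (X j t)) 0; first by rewrite normr0 mul0r mulr0.
  rewrite ger0_norm// mulrC ler_wpM2r// (le_trans (hf' _ _))// mulrC ler_wpM2r//; lra.
pose a k j t := al j t * li j t ^+ k.
have ha k : (k <= 2)%N -> forall t : R, spectrum A t%:C ->
    \sum_(j <- r) rnorm (a k j t) ^+ 2 <= 2 ^+ 2.
  move=> k2 t st; rewrite (le_trans _ (sum_bound k2 (M_spec _ _ bA st)))//.
  apply: ler_sum => j _; rewrite /a rnormM exprMn -li_norm.
  suff -> : rnorm (li j t ^+ k) = rnorm (li j t) ^+ k by rewrite exprAC.
  by elim: (k) => [|m IH]; rewrite ?rnorm1// !exprS rnormM IH.
(* The constant 2 bounds the square function of [al j * li j ^+ k] for [k <= 2], and [4 * w] that of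
   [g j]. *)
have mult k F Z : (k <= 2)%N -> (forall j, calc A (a k j) (F j)) -> opb eta Z ->
    rnorm (\sum_(j <- r) F j (Z (G j u))) <= 2 * (4 * w) * eta * rnorm u.
  move=> k2 cF bZ.
  apply: (calc_multiplier hip H_neq0 M0 bA sA bB sB cF cG _ _ eta0 bZ (ha k k2)) => //.
  by rewrite mulr_ge0.
have c0 j : calc A (a 0 j) (E j) by apply: calc_ext (hE j) => t _; rewrite /a expr0 mulr1.
have c1 j : calc A (a 1 j) (E j \o P A j) := calcM hip H_neq0 M0 bA sA (hE j) (cPA j).
have c2 j : calc A (a 2 j) (E j \o (P A j \o P A j)).
  exact: (calcM hip H_neq0 M0 bA sA (hE j) (calcM hip H_neq0 M0 bA sA (cPA j) (cPA j))).
have m0 := mult 0 _ _ isT c0 bY2; have m1 := mult 1 _ _ isT c1 bY1.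
have m2 := mult 2 _ _ isT c2 bY.
have -> : FA (Y u) - Y (FB u) = F1 (Y u) - \sum_(j <- r) E j (Y (D j u)).
  rewrite -{1}(sumE (FA (Y u))) -{1}(sumE (Y (FB u))) /F1 -!sumrB; apply: eq_bigr => j _.
  rewrite -!(linear_fB (lE j)) /D (linear_fB lY) (linear_fZ lY) opprB addrA.
  by rewrite subrK.
set S2 := (X in rnorm X <= _) in m2; set S1 := (X in rnorm X <= _) in m1.
set S0 := (X in rnorm X <= _) in m0.
have -> : \sum_(j <- r) E j (Y (D j u)) = S2 - S1 - (S1 - S0).
  rewrite /S2 /S1 /S0 -!sumrB; apply: eq_bigr => j _ /=.
  by rewrite YD !(linear_fB (lE j)).
have b1 : rnorm (F1 (Y u)) <= 2 * w * (eta * rnorm u).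
  by rewrite (le_trans (bF1.2 _))// ler_wpM2l ?mulr_ge0//; apply: bY.2.
have := ler_rnormB (F1 (Y u)) (S2 - S1 - (S1 - S0)).
have := ler_rnormB (S2 - S1) (S1 - S0); have := ler_rnormB S2 S1; have := ler_rnormB S1 S0.
lra.
Qed.

End Local.

                                        

(** * Cayley transforms and averaging along a discrete flow *)

Section Smoothing.
Context {R : realType} {H : completeNormedModType R[i]}.
Variable ip : {dot H for Num.conj}.
Hypothesis hip : hilbert_inner ip.
Implicit Types (X : H -> H) (u : H).

Definition commutator (A B X : H -> H) : H -> H := (A \o X) \- (X \o B).

Definition cayley (s : R) (A : H -> H) : H -> H := fun u => u + (0 +i* s) *: A u.

Lemma cayleyC s t (A : H -> H) u : linear A ->
  cayley s A (cayley t A u) = cayley t A (cayley s A u).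
Proof.
move=> lA; rewrite /cayley !(linear_fD lA) !(linear_fZ lA) !scalerDr !scalerA.
by rewrite -!addrA; congr (_ + _); rewrite addrCA mulrC.
Qed.

Section Cayley.
Variables (A : H -> H) (M : R).
Hypotheses (M0 : 0 < M) (bA : opb M A) (sA : self_adjoint ip A).

Let lA : linear A. Proof. by case: bA. Qed.

Lemma cayley_linear s : linear (cayley s A).
Proof.
move=> a x y; rewrite /cayley lA !scalerDr !scalerA addrACA; congr (_ + (_ + _)).
by rewrite mulrC.
Qed.

(** The right-hand side is even in [s], which is why the quotient of [1 + i s A] by [1 - i s A] is
    isometric. *)
Lemma cayley_norm2 s u : rnorm (cayley s A u) ^+ 2 = rnorm u ^+ 2 + s ^+ 2 * rnorm (A u) ^+ 2.
Proof.
have := rnorm_shift2 hip sA 1 s 0 u.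
by rewrite scale0r subr0 scale1r expr1n mul1r.
Qed.

Lemma cayley_normN s u : rnorm (cayley (- s) A u) = rnorm (cayley s A u).
Proof.
apply/eqP; rewrite -(@eqrXn2 _ 2) ?rnorm_ge0// !cayley_norm2 sqrrN//.
Qed.

Lemma cayley_norm_ge s u : rnorm u <= rnorm (cayley s A u).
Proof.
rewrite -ler_sqr ?nnegrE ?rnorm_ge0// cayley_norm2 lerDl.
by rewrite mulr_ge0// sqr_ge0.
Qed.

Lemma cayley_norm_le s u : 0 <= s -> s * M <= 1 -> rnorm (cayley s A u) <= 2 * rnorm u.
Proof.
move=> s0 sM; rewrite /cayley (le_trans (ler_rnormD _ _))// mulr_natl mulr2n lerD2l.
have -> : rnorm ((0 +i* s) *: A u) = s * rnorm (A u).
  rewrite rnormZ; congr (_ * _); apply/eqP; rewrite -(@eqrXn2 _ 2) ?rnorm_ge0//.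
  by rewrite rnorm_sqr/= expr0n add0r.
rewrite (le_trans (ler_wpM2l s0 (bA.2 u)))// mulrA -[leRHS]mul1r.
by rewrite ler_wpM2r ?rnorm_ge0.
Qed.

(** [1 + i s A] equals [i s (A - i / s)], and [i / s] is not real, hence outside the spectrum. *)
Lemma cayley_inverse s : s != 0 -> exists S, [/\ opb 1 S,
  forall u, S (cayley s A u) = u & forall u, cayley s A (S u) = u].
Proof.
move=> s0; pose z : R[i] := 0 +i* s^-1.
have : ~ spectrum A z.
  by move=> /(spectrum_real hip M0 bA sA)/eqP; rewrite /= invr_eq0 (negPf s0).
move=> /contrapT[S [[lS bS] SA AS]].
have cE u : cayley s A u = (0 +i* s) *: (A u - z *: u).
  rewrite /cayley scalerBr scalerA.
  have -> : (0 +i* s) * z = -1 by rewrite /z; simpc; rewrite mulfV.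
  by rewrite scaleN1r opprK addrC.
have z1 : (0 +i* s) * (0 -i* s^-1) = 1 :> R[i] by simpc; rewrite mulfV.
pose S' u := S ((0 -i* s^-1) *: u).
have AS' u : cayley s A (S' u) = u by rewrite cE AS scalerA z1 scale1r.
exists S'; split=> [|u|//]; last by rewrite /S' cE scalerA mulrC z1 scale1r.
split=> [a x y|u]; first by rewrite /S' scalerDr scalerA mulrC -scalerA lS.
by rewrite mul1r -{2}(AS' u) cayley_norm_ge.
Qed.

End Cayley.

Variables (A B : H -> H) (M tau : R).
Hypotheses (M0 : 0 < M) (bA : opb M A) (sA : self_adjoint ip A).
Hypotheses (bB : opb M B) (sB : self_adjoint ip B).
Hypotheses (tau0 : 0 < tau) (tauM : tau * M <= 1).

Let lA : linear A. Proof. by case: bA. Qed.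
Let lB : linear B. Proof. by case: bB. Qed.

                                                                              
                                                                      
                  
(** [U] and [W] are the Cayley transforms of [A] and of [- B]. The last clause is the discrete
    counterpart of the derivative of [e^(isA) X e^(-isB)]: in the difference of
    [(1 + i tau A) X (1 - i tau B)] and [(1 - i tau A) X (1 + i tau B)] the terms [X] and [A X B]
    cancel. *)
Lemma unitary_flow : exists U W : H -> H, [/\ opb 1 U, opb 1 W,
  (forall u, A (U u) = U (A u)), (forall u, B (W u) = W (B u)) &
  (forall X, linear X -> forall u,
    cayley (- tau) A (U (X (W (cayley tau B u))) - X (cayley tau B u)) =
    (0 +i* (2 * tau)) *: commutator A B X u)].
Proof.
have tn0 : tau != 0 by rewrite gt_eqF.
have ntn0 : - tau != 0 by rewrite oppr_eq0.
have [RA [bRA RA1 RA2]] := cayley_inverse M0 bA sA ntn0.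
have [RB [bRB RB1 RB2]] := cayley_inverse M0 bB sB tn0.
exists (cayley tau A \o RA), (cayley (- tau) B \o RB).
have commR (C S : H -> H) s u : linear C -> (forall u, S (cayley s C u) = u) ->
    (forall u, cayley s C (S u) = u) -> C (S u) = S (C u).
  move=> lC S1 S2; rewrite -{2}(S2 u) -[LHS]S1; congr S.
  by rewrite /cayley (linear_fD lC) (linear_fZ lC).
have commC (C : H -> H) s u : linear C -> C (cayley s C u) = cayley s C (C u).
  by move=> lC; rewrite /cayley (linear_fD lC) (linear_fZ lC).
split.
- split=> [a x y|u] /=; first by rewrite bRA.1 (cayley_linear bA).
  by rewrite -cayley_normN// RA2 mul1r.
- split=> [a x y|u] /=; first by rewrite bRB.1 (cayley_linear bB).
  by rewrite cayley_normN// RB2 mul1r.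
- by move=> u /=; rewrite commC// (commR _ _ _ _ lA RA1 RA2).
- by move=> u /=; rewrite commC// (commR _ _ _ _ lB RB1 RB2).
move=> X lX u /=; rewrite RB1 (linear_fB (cayley_linear bA _)) cayleyC// RA2.
have zmod (p q r v : H) : p - q + (r - v) - (p + q - (r + v)) = (r + r) - (q + q).
  rewrite opprB (addrC (r + v)) addrACA addrC.
  have -> : p - q - (p + q) = - (q + q) by rewrite opprD addrACA subrr add0r -opprD.
  by have -> : r - v + (r + v) = r + r by rewrite addrACA addNr addr0.
have iN : (0 +i* - tau) = - (0 +i* tau) :> R[i] by simpc.
rewrite /cayley /commutator /= iN !(linear_fD lX, linear_fZ lX, linear_fD lA, linear_fZ lA).
rewrite !(scaleNr, scalerDr, scalerN) zmod.
have -> : (0 +i* (2 * tau)) = 0 +i* tau + (0 +i* tau) :> R[i] by simpc; congr (_ +i* _); ring.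
by rewrite !scalerDl.
Qed.

(** [a X] is the mean of [U^j X W^j] over [j < n]. Each step moves [X] by at most [2 tau D], so the
    mean stays close to [X]. One more step changes the mean only by its two end terms, of size
    [2 K / n], which bounds its commutator. *)
Lemma smoothing n : (0 < n)%N -> exists a : (H -> H) -> H -> H,
  [/\ forall (K : R) X, 0 <= K -> opb K X -> opb K (a X),
      forall X, linear X -> commutator A B (a X) = a (commutator A B X),
      forall (D : R) X, 0 <= D -> linear X -> opb D (commutator A B X) ->
        opb (2 * (n%:R * tau) * D) (X \- a X),
      forall (K : R) X, 0 <= K -> opb K X -> opb (4 / (n%:R * tau) * K) (commutator A B (a X)) &
      n = 1%N -> forall X, a X = X].
Proof.
move=> n0; have [U [W [bU bW UA WB flowE]]] := unitary_flow.
pose flow j X u := iter j U (X (iter j W u)).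
have n0R : 0 < (n%:R : R) by rewrite ltr0n.
have flowS j X u : flow j.+1 X u = U (flow j X (W u)) by rewrite /flow iterS -iterSr.
have flow_opb j K X : 0 <= K -> opb K X -> opb K (flow j X).
  move=> K0 bX; elim: j => [//|j IH].
  have := opb_comp ler01 bU (opb_comp K0 IH bW).
  rewrite mul1r mulr1; congr opb; apply/funext => u; exact/esym/flowS.
have flow_lin j X : linear X -> linear (flow j X).
  move=> lX; elim: j => [//|j IH] b x y.
  by rewrite !flowS bW.1 IH bU.1.
have flow_comm j X u : commutator A B (flow j X) u = flow j (commutator A B X) u.
  elim: j => [//|j IH] in u *.
  rewrite flowS -IH /commutator /= !flowS UA -WB (linear_fB bU.1)//.
(* The factors [1 - i tau A] and [1 + i tau B] never decrease norms, so removing them from the flow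
   identity costs nothing. *)
have step_le Y D : 0 <= D -> linear Y -> opb D (commutator A B Y) ->
    forall u, rnorm (U (Y (W u)) - Y u) <= 2 * tau * D * rnorm u.
  move=> D0 lY bD u.
  have [RB [_ _ RB2]] := cayley_inverse M0 bB sB (lt0r_neq0 tau0).
  rewrite -(RB2 u) (le_trans (cayley_norm_ge sA (- tau) _))// flowE//.
  rewrite rnormZ -mulrA; apply: ler_pM; rewrite ?rnorm_ge0//.
    rewrite -ler_sqr ?nnegrE ?rnorm_ge0 ?mulr_ge0 ?(ltW tau0)//.
    by rewrite rnorm_sqr/= expr0n add0r.
  by rewrite (le_trans (bD.2 _))// ler_wpM2l// (cayley_norm_ge sB).
(* In the opposite direction each Cayley factor costs at most 2, thanks to [tau * M <= 1]. *)
have step_ge Y E : 0 <= E -> linear Y -> (forall u, rnorm (U (Y (W u)) - Y u) <= E * rnorm u) ->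
    forall u, rnorm (commutator A B Y u) <= 2 * E / tau * rnorm u.
  move=> E0 lY bE u.
  have t20 : 0 < 2 * tau by rewrite mulr_gt0.
  have sE : rnorm (0 +i* (2 * tau) : R[i]) = 2 * tau.
    apply/eqP; rewrite -(@eqrXn2 _ 2) ?rnorm_ge0 ?(ltW t20)//.
    by rewrite rnorm_sqr/= expr0n add0r.
  rewrite -(ler_pM2l t20) -sE -rnormZ -flowE// sE cayley_normN//.
  rewrite (le_trans (cayley_norm_le bA _ (ltW tau0) tauM))//.
  have -> : 2 * tau * (2 * E / tau * rnorm u) = 2 * (E * (2 * rnorm u)).
    by field; rewrite gt_eqF.
  rewrite ler_pM2l// (le_trans (bE _))// ler_wpM2l//.
  exact: (cayley_norm_le bB _ (ltW tau0) tauM).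
have flow_le D X j : 0 <= D -> linear X -> opb D (commutator A B X) ->
    forall u, rnorm (X u - flow j X u) <= j%:R * (2 * tau * D) * rnorm u.
  move=> D0 lX bD; elim: j => [|j IH] u; first by rewrite subrr rnorm0 !mul0r.
  rewrite -(subrK (flow j X u) (X u)) -addrA -natr1 mulrDl mul1r mulrDl.
  rewrite (le_trans (ler_rnormD _ _))// lerD// rnorm_distC flowS.
  apply: step_le => //; first exact: flow_lin.
  have := flow_opb j _ _ D0 bD; congr opb; apply/funext => v; exact/esym/flow_comm.
pose a X u := (n%:R^-1)%:C *: \sum_(j < n) flow j X u.
have a_lin X : linear X -> linear (a X).
  move=> lX b x y; rewrite /a scalerA mulrC -scalerA -scalerDr; congr (_ *: _).
  rewrite scaler_sumr -big_split/=; apply: eq_bigr => j _; exact: flow_lin.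
have inC : rnorm (n%:R^-1)%:C = n%:R^-1 :> R by rewrite rnorm_real ger0_norm.
have sum_n (x : R) : n%:R^-1 * \sum_(j < n) x = x.
  by rewrite sumr_const card_ord -[x *+ n]mulr_natl mulKf// gt_eqF.
exists a; split.
- move=> K X K0 bX; split=> [|u]; first exact: a_lin bX.1.
  rewrite /a rnormZ inC -[leRHS]sum_n ler_wpM2l ?invr_ge0 ?ler0n//.
  rewrite (le_trans (ler_rnorm_sum _ _ _))//; apply: ler_sum => j _.
  exact: (flow_opb j _ _ K0 bX).2.
- move=> X lX; apply/funext => u; rewrite /commutator /a /= (linear_fZ lA) (linear_fsum lA).
  rewrite -scalerBr -sumrB; congr (_ *: _); apply: eq_bigr => j _; exact: flow_comm.
- move=> D X D0 lX bD; split=> [b x y|u] /=.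
    by rewrite lX (a_lin X lX) scalerBr opprD addrACA.
  have -> : X u - a X u = (n%:R^-1)%:C *: \sum_(j < n) (X u - flow j X u).
    rewrite sumrB sumr_const card_ord scalerBr; congr (_ - _).
    rewrite -[X u *+ n]scaler_nat scalerA -(rmorph_nat (real_complex R)).
    by rewrite -rmorphM mulVf ?scale1r// gt_eqF.
  rewrite rnormZ inC -[leRHS]sum_n ler_wpM2l ?invr_ge0 ?ler0n//.
  rewrite (le_trans (ler_rnorm_sum _ _ _))//; apply: ler_sum => j _.
  rewrite (le_trans (flow_le D X j D0 lX bD u))// ler_wpM2r ?rnorm_ge0//.
  have -> : 2 * (n%:R * tau) * D = n%:R * (2 * tau * D) by ring.
  by rewrite ler_wpM2r ?ler_nat 1?ltnW// !mulr_ge0 ?(ltW tau0).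
- move=> K X K0 bX; have lX := bX.1; split=> [b x y|u].
    by rewrite /commutator /= bB.1 !(a_lin X lX) lA scalerBr opprD addrACA.
  rewrite (_ : _ * K = 2 * (2 * K / n%:R) / tau); last by field; rewrite !gt_eqF.
  apply: step_ge; rewrite ?divr_ge0 ?mulr_ge0//; first exact: a_lin.
  move=> v.
  have -> : U (a X (W v)) - a X v = (n%:R^-1)%:C *: (flow n X v - X v).
    rewrite /a (linear_fZ bU.1) (linear_fsum bU.1) -scalerBr -sumrB; congr (_ *: _).
    rewrite -(big_mkord xpredT (fun j => U (flow j X (W v)) - flow j X v)).
    rewrite (eq_bigr (fun j => flow j.+1 X v - flow j X v)) => [|j _]; last by rewrite flowS.
    by rewrite telescope_sumr.
  rewrite rnormZ inC [2 * K / _]mulrC -mulrA ler_wpM2l ?invr_ge0 ?ler0n//.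
  rewrite (le_trans (ler_rnormB _ _))// [2 * K]mulr_natl mulr2n mulrDl lerD ?(bX.2)//.
  exact: (flow_opb n _ _ K0 bX).2.
- by move=> n1 X; apply/funext => u; rewrite /a n1 big_ord1 invr1 scale1r.
Qed.

End Smoothing.

                                            

(** * Moduli of continuity and the integral [omega_star] *)

Section Modulus.
Context {R : realType}.
Variable w : R -> R.
Hypothesis hw : modulus_of_continuity w.

Lemma modulus_le x y : 0 <= x -> x <= y -> w x <= w y.
Proof.
case: hw => mono _ _ _ _ x0 xy.
by apply: mono => //; rewrite in_itv/= andbT// (le_trans x0).
Qed.

Lemma modulus_ge0 x : 0 <= x -> 0 <= w x.
Proof. by move=> x0; case: hw => _ _ <- _ _; exact: modulus_le. Qed.

(** Subadditivity over [m] copies of [h], where [m] is the integer part of [s / h] plus one. *)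
Lemma modulus_dilate h s : 0 < h -> 0 <= s -> w s <= w h * (1 + s / h).
Proof.
move=> h0 s0; have wn m : w (m%:R * h) <= m%:R * w h.
  elim: m => [|m IH]; first by rewrite !mul0r; case: hw => _ _ ->.
  rewrite -natr1 !mulrDl !mul1r; case: hw => _ _ _ _ sub.
  by rewrite (le_trans (sub _ _ _ _)) ?lerD2r// ?mulr_ge0// ltW.
have sh : 0 <= s / h by rewrite divr_ge0// ltW.
pose m := (Num.truncn (s / h)).+1.
rewrite (le_trans (@modulus_le s (m%:R * h) s0 _)) ?(le_trans (wn m))//.
  by rewrite -ler_pdivrMr// ltW// truncnS_gt.
rewrite mulrC ler_wpM2l ?modulus_ge0 ?(ltW h0)// /m -natr1 addrC lerD2l.
by rewrite truncn_le.
Qed.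

Lemma modulus_cvg0 e : 0 < e -> exists2 d, 0 < d & w d <= e.
Proof.
move=> e0; case: hw => _ /subspace_continuousP cw w00 _ _.
have := cw 0; rewrite /= in_itv/= lexx => /(_ isT) /cvgrPdist_lt /(_ _ e0).
move=> /nbhs_ballP[d /= d0 hd].
have d20 : 0 < d / 2 by rewrite divr_gt0.
exists (d / 2) => //.
have : `|w 0 - w (d / 2)| < e.
  apply: hd; last by rewrite /= in_itv/= andbT ltW.
  by rewrite /ball/= sub0r normrN gtr0_norm// ltr_pdivrMr// ltr_pMr// ltr1n.
rewrite w00 sub0r normrN ger0_norm ?modulus_ge0 ?(ltW d20)//; exact: ltW.
Qed.

(** On [[b, 2b[] the integrand is at least [w(b) / (4 b^2)], so this block contributes at least
    [w(b) / (4 b)]; the blocks [b = 2^k a] are split off one at a time. The integral may be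
    infinite. *)
Lemma modulus_integral_ge n (a : R) : 0 < a ->
  ((\sum_(k < n) w (2 ^+ k * a) / (4 * (2 ^+ k * a)))%:E <=
   \int[lebesgue_measure]_(t in `[a, +oo[) (w t / t ^+ 2)%:E)%E.
Proof.
have g0 (t : R) : 0 < t -> (0 <= (w t / t ^+ 2)%:E)%E.
  by move=> t0; rewrite lee_fin divr_ge0 ?sqr_ge0// modulus_ge0// ltW.
have mg (b : R) : 0 < b ->
    measurable_fun `[b, +oo[%classic (EFin \o (fun t : R => w t / t ^+ 2)).
  move=> b0; apply/measurable_EFinP/measurable_funM.
    apply: subspace_continuous_measurable_fun => //.
    have [_ cw _ _ _] := hw; apply: continuous_subspaceW cw.
    by move=> t; rewrite /= !in_itv/= !andbT; apply: le_trans; apply: ltW.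
  apply: subspace_continuous_measurable_fun => //.
  apply: continuous_in_subspaceT => t; rewrite inE/= in_itv/= andbT => bt.
  apply: (@continuousV _ _ (fun x : R => x ^+ 2) t); last exact: exprn_continuous.
  by rewrite expf_neq0// gt_eqF// (lt_le_trans b0).
elim: n a => [|n IH] a a0.
  rewrite big_ord0 integral_ge0// => t /=; rewrite in_itv/= andbT => at_.
  by apply: g0; rewrite (lt_le_trans a0).
have a20 : 0 < 2 * a by rewrite mulr_gt0.
have a2 : a <= 2 * a by rewrite ler_peMl ?(ltW a0)// ler1n.
have -> : `[a, +oo[%classic = `[a, 2 * a[%classic `|` `[2 * a, +oo[%classic :> set R.
  by apply: itv_bndbnd_setU; rewrite bnd_simp.
rewrite ge0_integral_setU//=; last 3 first.
- rewrite -itv_bndbnd_setU ?bnd_simp//; exact: mg.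
- move=> t; rewrite /= !in_itv/= andbT => at_; apply: g0; case: at_ => [/andP[at_ _]|at_].
    by rewrite (lt_le_trans a0).
  by rewrite (lt_le_trans a20).
- apply/disj_setPS => t [] /=; rewrite !in_itv/= andbT => /andP[_ t1] t2.
  by rewrite ltNge t2 in t1.
rewrite big_ord_recl EFinD leeD//.
  apply: (@le_trans _ _ (\int[lebesgue_measure]_(t in `[a, (2 * a)%R[)
    (cst (w a / (4 * a ^+ 2))%:E) t)%E).
    rewrite integral_cst//= lebesgue_measure_itv/= lte_fin ltr_pMl// ltr1n -EFinB -EFinM lee_fin.
    by rewrite expr0 mul1r le_eqVlt; apply/orP; left; apply/eqP; field; rewrite gt_eqF.
  apply: ge0_le_integral => //.
  - move=> t _; rewrite lee_fin; apply: divr_ge0; first by rewrite modulus_ge0 ?ltW.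
    by rewrite mulr_ge0 ?sqr_ge0.
  - apply: measurable_funS (mg a a0) => //.
    by move=> t; rewrite /= !in_itv/= andbT => /andP[].
  move=> t; rewrite /= in_itv/= => /andP[t1 t2]; rewrite lee_fin.
  have t0 : 0 < t by rewrite (lt_le_trans a0).
  apply: ler_pM; rewrite ?invr_ge0 ?mulr_ge0 ?sqr_ge0 ?modulus_ge0 ?(ltW a0)//.
    by rewrite modulus_le// ltW.
  rewrite lef_pV2 ?posrE ?mulr_gt0 ?exprn_gt0//.
  have -> : 4 * a ^+ 2 = (2 * a) ^+ 2 by ring.
  by rewrite lerXn2r ?nnegrE ?ltW.
have := IH _ a20; congr (_ <= _)%E; congr (_%:E); apply: eq_bigr => k _.
by rewrite lift0 exprSr !mulrA.
Qed.

Lemma modulus_omega_star n (a : R) : 0 < a ->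
  ((\sum_(k < n) 2^-1 ^+ k * w (2 ^+ k * a))%:E <= 4%:E * omega_star w a)%E.
Proof.
move=> a0; rewrite /omega_star a0 muleA -EFinM.
have a40 : (0 <= (4 * a)%:E)%E by rewrite lee_fin mulr_ge0// ltW.
apply: le_trans (lee_wpmul2l a40 (modulus_integral_ge n a0)).
rewrite -EFinM lee_fin mulr_sumr le_eqVlt; apply/orP; left; apply/eqP.
apply: eq_bigr => k _; have k0 : (2 : R) ^+ k != 0 by rewrite expf_neq0.
by rewrite exprVn; field; rewrite k0 gt_eqF.
Qed.

Variable f : R -> R[i].
Hypothesis hf : Lambda_space w f.

Lemma Lambda_normP : exists2 L : R, 0 <= L & Lambda_norm w f = L%:E /\
  forall x y, rnorm (f x - f y) <= L * w `|x - y|.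
Proof.
have ub (p : R * R) : p.1 != p.2 ->
    ((rnorm (f p.1 - f p.2) / w `|p.1 - p.2|)%:E <= Lambda_norm w f)%E.
  by move=> p12; apply: ereal_sup_ubound; exists p.
have N0 : (0 <= Lambda_norm w f)%E.
  apply: le_trans (ub (0, 1) _); last by rewrite /= eq_sym oner_eq0.
  by rewrite lee_fin divr_ge0 ?rnorm_ge0 ?modulus_ge0.
exists (fine (Lambda_norm w f)); first exact: fine_ge0.
have NE : Lambda_norm w f = (fine (Lambda_norm w f))%:E.
  by rewrite fineK// ge0_fin_numE.
split=> // x y; have [->|xy] := eqVneq x y.
  by rewrite !subrr rnorm0 normr0; case: hw => _ _ -> _ _; rewrite mulr0.
have := ub (x, y) xy; rewrite NE lee_fin ler_pdivrMr//.
by case: hw => _ _ _ + _; apply; rewrite normr_gt0 subr_eq0.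
Qed.

End Modulus.

(** * Dyadic decomposition of [T] and summation of the scales *)

Section Telescoping.
Context {R : realType} {H : completeNormedModType R[i]}.
Variable ip : {dot H for Num.conj}.
Hypothesis hip : hilbert_inner ip.
Hypothesis H_neq0 : exists x : H, x != 0.
Variables (w : R -> R) (f : R -> R[i]) (L : R).
Hypotheses (hw : modulus_of_continuity w) (L0 : 0 <= L).
Hypothesis hf : forall x y, rnorm (f x - f y) <= L * w `|x - y|.
Variables (M : R) (A B : H -> H).
Hypothesis M0 : 0 < M.
Hypotheses (bA : opb M A) (sA : self_adjoint ip A).
Hypotheses (bB : opb M B) (sB : self_adjoint ip B).

Let lA : linear A. Proof. by case: bA. Qed.

(** With [L w(d) <= e / 2], [modulus_dilate] bounds the oscillation of [f] by [e/2 (1 + s/d)], which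
    is at most [e + e/2 (s/d)^2]: the quadratic form of continuity. *)
Lemma calc_modulus (C : H -> H) : opb M C -> self_adjoint ip C -> calc C f (fun_calc f C).
Proof.
move=> bC sC.
have [|S cS] := calc_exists_quad (phi := f) hip H_neq0 M0 bC sC; last first.
  exact: (calc_fun_calc hip H_neq0 M0 bC sC cS).
move=> e e0; have [d d0 wd] : exists2 d, 0 < d & L * w d <= e / 2.
  have L10 : 0 < L + 1 by rewrite ltr_wpDl.
  have e1 : 0 < e / 2 / (L + 1) by rewrite !divr_gt0.
  have [d d0 wd] := modulus_cvg0 hw e1; exists d => //.
  have -> : e / 2 = (L + 1) * (e / 2 / (L + 1)) by field; rewrite gt_eqF.
  by apply: ler_pM => //; [rewrite (modulus_ge0 hw)// ltW|rewrite lerDl].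
exists (e / 2 / d ^+ 2) => x y _ _; apply: (le_trans (hf x y)).
set s := `|x - y|; have s0 : 0 <= s := normr_ge0 _.
rewrite -[(x - y) ^+ 2]real_normK ?num_real// -/s.
apply: (@le_trans _ _ (L * (w d * (1 + s / d)))).
  by rewrite ler_wpM2l// modulus_dilate.
rewrite mulrA (@le_trans _ _ (e / 2 * (1 + s / d)))//.
  by rewrite ler_wpM2r// addr_ge0// divr_ge0// ltW.
rewrite -subr_ge0.
have -> : e + e / 2 / d ^+ 2 * s ^+ 2 - e / 2 * (1 + s / d) =
    e / 2 * ((s / d - 1 / 2) ^+ 2 + 3 / 4) by field; rewrite gt_eqF.
by rewrite mulr_ge0 ?(divr_ge0 (ltW e0))// addr_ge0 ?sqr_ge0.
Qed.

Let FA := fun_calc f A.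
Let FB := fun_calc f B.
Let cFA : calc A f FA := calc_modulus bA sA.
Let cFB : calc B f FB := calc_modulus bB sB.

Lemma commutatorZ c X : commutator A B (c \*: X) = c \*: commutator A B X.
Proof. by apply/funext => u; rewrite /commutator /= (linear_fZ lA) scalerBr. Qed.

Lemma commutatorB X Y : commutator A B (X \- Y) = commutator A B X \- commutator A B Y.
Proof.
apply/funext => u; rewrite /commutator /= (linear_fB lA).
by rewrite !opprD !opprK -!addrA; congr (_ + _); rewrite addrCA.
Qed.

Lemma local_step h eta Y : 0 < h -> 0 <= eta -> opb eta Y ->
  opb (h * eta) (commutator A B Y) ->
  opb (h ^+ 2 * eta) (commutator A B (commutator A B Y)) ->
  forall u, rnorm (FA (Y u) - Y (FB u)) <= 34 * (L * w h) * eta * rnorm u.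
Proof.
move=> h0 eta0 bY b1 b2; have hn : rnorm (h^-1)%:C = h^-1 :> R.
  by rewrite rnorm_real ger0_norm// invr_ge0 ltW.
have h1 := opbZ (h^-1)%:C b1.
have h2 := opbZ (h^-1)%:C (opbZ (h^-1)%:C b2).
rewrite hn mulKf ?gt_eqF// in h1.
have hh : h^-1 * (h^-1 * (h ^+ 2 * eta)) = eta by field; rewrite gt_eqF.
rewrite hn hh -commutatorZ in h2.
apply: (local_commutator hip H_neq0 M0 bA sA bB sB cFA cFB _ h0 _ eta0 bY h1 h2) => //.
  by rewrite mulr_ge0 ?(modulus_ge0 hw)// ltW.
move=> x y; rewrite (le_trans (hf x y))// -mulrA ler_wpM2l//.
exact: modulus_dilate.
Qed.

(** The number [N] of scales depends on the norms of [A] and [B], but the constant does not. The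
    factor 204 is [34 * 6], where 6 is the common constant for a dyadic piece and its two
    commutators. *)
Lemma commutator_telescope T t d : 0 < d -> 0 <= t -> opb t T ->
  opb (d * t) (commutator A B T) -> exists N, forall u,
  rnorm (FA (T u) - T (FB u)) <=
    204 * L * t * (\sum_(i < N) 2^-1 ^+ i * w (2 ^+ i * d)) * rnorm u.
Proof.
move=> d0 t0 bT bD.
(* The time step is [1 / h N], admissible for the Cayley bounds because [M <= h N]. Averaging over
   [2^(N - k)] steps takes time [1 / h k]; for [k = N] it is a single term, so [a N T] is [T]. *)
have [N hN] : exists N, M <= 2 ^+ N * d.
  exists (Num.truncn (M / d)).+1; rewrite -ler_pdivrMr// (le_trans (ltW (truncnS_gt _)))//.
  by rewrite -natrX ler_nat ltnW// ltn_expl.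
pose h k := 2 ^+ k * d; have h0 k : 0 < h k by rewrite mulr_gt0 ?exprn_gt0.
have tau0 : 0 < (h N)^-1 by rewrite invr_gt0.
have tauM : (h N)^-1 * M <= 1 by rewrite mulrC ler_pdivrMr// mul1r.
have n0 k : (0 < 2 ^ (N - k))%N by rewrite expn_gt0.
have /choice[a ha] k := smoothing hip M0 bA sA bB sB tau0 tauM (n0 k).
have lT := bT.1; have dt0 : 0 <= d * t by rewrite mulr_ge0// ltW.
have nh k : (k <= N)%N -> (2 ^ (N - k))%:R * (h N)^-1 = (h k)^-1 :> R.
  move=> kN; have h2 : (2 : R) ^+ k != 0 by rewrite expf_neq0.
  have h3 : (2 : R) ^+ (N - k) != 0 by rewrite expf_neq0.
  rewrite /h natrX -{2}(subnK kN) exprD; field.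
  by rewrite h2 h3 gt_eqF.
have a_opb k : opb t (a k T) by have [h1 _ _ _ _] := ha k; apply: h1.
have a_comm k : commutator A B (a k T) = a k (commutator A B T).
  by have [_ h1 _ _ _] := ha k; apply: h1.
have a_opb1 k : opb (d * t) (commutator A B (a k T)).
  by rewrite a_comm; have [h1 _ _ _ _] := ha k; apply: h1.
have a_opb2 k : (k <= N)%N -> opb (4 * h k * (d * t)) (commutator A B (commutator A B (a k T))).
  move=> kN; rewrite a_comm; have [_ _ _ h1 _] := ha k.
  by have := h1 _ _ dt0 bD; rewrite nh// invrK.
have a_close k : (k <= N)%N -> opb (2 / h k * (d * t)) (T \- a k T).
  move=> kN; have [_ _ h1 _ _] := ha k.
  by have := h1 _ _ dt0 lT bD; rewrite nh.
have lFA : linear FA by case: cFA.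
suff claim k : (k <= N)%N -> forall u, rnorm (FA (a k T u) - a k T (FB u)) <=
    204 * L * t * (\sum_(i < k.+1) 2^-1 ^+ i * w (h i)) * rnorm u.
  exists N.+1 => u; have := claim N (leqnn N) u.
  have [_ _ _ _ h1] := ha N; rewrite h1 ?subnn ?expn0//.
elim: k => [_|k IH kN] u.
  rewrite big_ord1 expr0 mul1r.
  have -> : 204 * L * t * w (h 0%N) = 34 * (L * w (h 0%N)) * (6 * t) by ring.
  apply: local_step => //; first by rewrite mulr_ge0.
  - by apply: opb_le (a_opb 0%N); lra.
  - apply: opb_le (a_opb1 0%N); rewrite /h expr0 mul1r.
    by lra.
  - apply: opb_le (a_opb2 0%N _) => //; rewrite /h expr0 mul1r.
    by rewrite expr2; nra.
have {}IH := IH (ltnW kN) u.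
pose Y := a k.+1 T \- a k T.
have hS : h k.+1 = 2 * h k by rewrite /h exprS mulrA.
have dE : d = 2^-1 ^+ k.+1 * h k.+1.
  by rewrite /h mulrA -exprMn mulVf// expr1n mul1r.
set q := 2^-1 ^+ k.+1 in dE *; have q0 : 0 <= q by rewrite exprn_ge0.
(* Since [d = q * h k.+1], the bounds [2 / h] at two consecutive scales add up to [6 q t], and the
   second commutators [4 h] to [6 (h k.+1)^2 q t]; the first commutators give only 2. *)
have : rnorm (FA (Y u) - Y (FB u)) <= 34 * (L * w (h k.+1)) * (6 * (q * t)) * rnorm u.
  have qt0 : 0 <= q * t by rewrite mulr_ge0.
  apply: local_step => //; first by rewrite mulr_ge0.
  - have := opbB (a_close _ (ltnW kN)) (a_close _ kN).
    rewrite (_ : _ \- _ = Y); last first.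
      by apply/funext => v; rewrite /Y /= opprB addrC addrA subrK.
    apply: opb_le; rewrite {1 2}dE hS le_eqVlt; apply/orP; left; apply/eqP.
    by field; rewrite gt_eqF.
  - have := opbB (a_opb1 k.+1) (a_opb1 k); rewrite -commutatorB; apply: opb_le.
    have := mulr_ge0 (ltW (h0 k.+1)) qt0.
    by rewrite dE; lra.
  have := opbB (a_opb2 _ kN) (a_opb2 _ (ltnW kN)); rewrite -!commutatorB; apply: opb_le.
  by rewrite {1 2}dE hS le_eqVlt; apply/orP; left; apply/eqP; field.
have -> : FA (a k.+1 T u) - a k.+1 T (FB u) =
    FA (a k T u) - a k T (FB u) + (FA (Y u) - Y (FB u)).
  by rewrite /Y /= (linear_fB lFA) opprB [RHS]addrCA [X in _ = _ + X]addrA !subrK addrA subrK.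
move=> hY; rewrite (le_trans (ler_rnormD _ _))// (le_trans (lerD IH hY))//.
rewrite [in leRHS]big_ord_recr/= -/q le_eqVlt; apply/orP; left; apply/eqP.
ring.
Qed.

(** If [A T = T B], the local estimate holds at every scale [h] with the same [eta], and [w h] tends
    to zero. *)
Lemma commutator_zero T t : 0 <= t -> opb t T -> opb 0 (commutator A B T) ->
  forall u, FA (T u) - T (FB u) = 0.
Proof.
move=> t0 bT b0 u; apply/rnorm_eq0/eqP; rewrite eq_le rnorm_ge0 andbT.
apply: (@cvg0_le _ (34 * L * t * rnorm u) _ _ (@cvg_harmonic R)) => n.
set e := harmonic n; have e0 : 0 < e by rewrite invr_gt0.
have [h h0 wh] := modulus_cvg0 hw e0.
have z v : commutator A B T v = 0.
  by apply/rnorm_eq0/eqP; rewrite eq_le rnorm_ge0 andbT (le_trans (b0.2 _))// mul0r.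
have b00 : opb 0 (commutator A B (commutator A B T)).
  rewrite (_ : commutator A B _ = \0); first exact: opb_zero.
  by apply/funext => v; rewrite {1}/commutator /= !z (linear_f0 lA) subrr.
have b1 : opb (h * t) (commutator A B T) by apply: opb_le b0; rewrite mulr_ge0// ltW.
have b2 : opb (h ^+ 2 * t) (commutator A B (commutator A B T)).
  by apply: opb_le b00; rewrite mulr_ge0// sqr_ge0.
rewrite (le_trans (local_step h0 t0 bT b1 b2 u))//.
have -> : 34 * L * t * rnorm u * e = 34 * (L * e) * t * rnorm u by ring.
by rewrite ler_wpM2r ?rnorm_ge0// ler_wpM2r// ler_wpM2l// ler_wpM2l.
Qed.

End Telescoping.

Theorem theorem10p6 (R : realType) :
  exists c : R, 0 < c /\
  forall (w : R -> R), modulus_of_continuity w ->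
  forall (f : R -> R[i]), Lambda_space w f ->
  forall (H : completeNormedModType R[i]) (ip : {dot H for Num.conj}),
    hilbert_inner ip ->
  forall (A B T : H -> H),
    bounded_operator A -> self_adjoint ip A ->
    bounded_operator B -> self_adjoint ip B ->
    bounded_operator T -> (exists x, T x != 0) ->
    ((opnorm ((fun_calc f A \o T) \- (T \o fun_calc f B))%R)%:E <=
     c%:E * Lambda_norm w f * (opnorm T)%:E *
     omega_star w (opnorm ((A \o T) \- (T \o B)) / opnorm T)%R)%E.
Proof.
(* [816 = 204 * 4]: the telescoped bound times the loss in comparing the dyadic sum with
   [omega_star]. *)
exists 816; split=> [|w hw f hf H ip hip A B T]; first by rewrite ltr0n.
move=> /bounded_opb[M1 M10 bA1] sA.
move=> /bounded_opb[M2 M20 bB2] sB bT [x Tx].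
have [L L0 [LE hfL]] := Lambda_normP hw hf.
pose M := M1 + M2; have M0 : 0 < M by rewrite addr_gt0.
have bA : opb M A by apply: opb_le bA1; rewrite lerDl ltW.
have bB : opb M B by apply: opb_le bB2; rewrite lerDr ltW.
have ne : exists y : H, y != 0 by exists (T x).
have bt := opnorm_bound bT; set t := opnorm T in bt *.
have t0 : 0 < t.
  rewrite ltNge; apply: contra Tx => t0; apply/eqP/rnorm_eq0/eqP.
  rewrite eq_le rnorm_ge0 andbT (le_trans (bt.2 x))//.
  by rewrite mulr_le0_ge0// rnorm_ge0.
have bD : bounded_operator (commutator A B T).
  exact: opb_bounded (opbB (opb_comp (ltW M0) bA bt) (opb_comp (ltW t0) bt bB)).
rewrite -/(commutator A B T); set D := opnorm (commutator A B T).
have D0 : 0 <= D := opnorm_ge0 bD.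
have hD := opnorm_bound bD; rewrite -/D in hD.
rewrite LE.
(* Here [omega_star] takes its conventional value 0 at 0, and there is no starting scale
   [D / t > 0], so the left-hand side must be shown to vanish. *)
have [DE|Dn] := eqVneq D 0.
  rewrite DE in hD *.
  rewrite mul0r /omega_star ltxx mule0 lee_fin; apply: opnorm_le => //.
  rewrite (_ : _ \- _ = \0); first exact: opb_zero.
  apply/funext => u /=.
  exact: (commutator_zero hip ne hw L0 hfL M0 bA sA bB sB (ltW t0) bt hD).
have d0 : 0 < D / t by rewrite divr_gt0// lt_neqAle eq_sym Dn.
have [|N hN] := commutator_telescope hip ne hw L0 hfL M0 bA sA bB sB d0 (ltW t0) bt.
  by rewrite divfK ?gt_eqF.
set S := \sum_(i < N) _ in hN.
have S0 : 0 <= S.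
  apply: sumr_ge0 => i _; rewrite mulr_ge0 ?exprn_ge0// (modulus_ge0 hw)// mulr_ge0 ?exprn_ge0//.
  exact: ltW.
have Lt : 0 <= 204 * L * t by rewrite mulr_ge0 ?(ltW t0)// mulr_ge0 ?ler0n.
have LtS : 0 <= 204 * L * t * S := mulr_ge0 Lt S0.
have lFA := (calc_modulus hip ne hw L0 hfL M0 bA sA).1.
have lFB := (calc_modulus hip ne hw L0 hfL M0 bB sB).1.
apply: (@le_trans _ _ (204 * L * t * S)%:E).
  rewrite lee_fin; apply: opnorm_le => //; split=> [a y z|u] /=; last exact: hN.
  by rewrite bt.1 lFA lFB bt.1 scalerBr opprD addrACA.
have c0 : (0 <= (204 * L * t)%:E)%E by rewrite lee_fin.
have := lee_wpmul2l c0 (modulus_omega_star hw N d0).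
rewrite -/S -EFinM => /le_trans; apply.
have -> : (816%:E * L%:E * t%:E = (204 * L * t)%:E * 4%:E)%E.
  by rewrite -!EFinM; congr (_%:E); ring.
by rewrite muleA.
Qed.
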